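(* Let $1<p\leq q<+\infty$, and let $\mu$ and $\nu$ be two $\sigma$-finite Borel measures on $\mathbb{R}$. Set $$B=\sup_{x\in\mathbb{R}}\nu((-\infty,x])^{1/p^*}\,\mu([x,+\infty))^{1/q}.$$ If $A$ is the optimal constant such that for all $f:\mathbb{R}\to\mathbb{R}$, $$\left[\int_{\mathbb{R}}\left|\int_{(-\infty,x)}f(y)\,\nu(dy)\right|^q\mu(dx)\right]^{1/q}\leq A\left[\int_{\mathbb{R}}|f(x)|^p\,\nu(dx)\right]^{1/p},$$ then $$B\leq A\leq k_{q,p}\,B.$$
   Context: Here $p^*=p/(p-1)$ is the conjugate exponent of $p$. The constant $k_{q,p}$ is $$k_{q,p}=\left(\frac{r}{\mathrm{B}(1/r,(q-1)/r)}\right)^{1/p-1/q},\qquad r=\frac{q}{p}-1,\qquad \mathrm{B}(a,b)=\int_0^1x^{a-1}(1-x)^{b-1}\,dx,$$ where $\mathrm{B}(a,b)$ is the Beta function (not to be confused with the quantity $B$ in the claim); when $p=q$, the constant is $k_{p,p}=p^{1/p}(p^* )^{1/p^*}$.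
   Formalization: As printed, B ≤ A fails (μ=ν=δ₀ gives A=0, B=1). Proved: B ≤ A ≤ kB with inner integral over (-∞,x]; for (-∞,x), A ≤ kB always, and B ≤ A if μ and ν share no atom. *)

(* Defs.v *)
From HB Require Import structures.
From mathcomp Require Import all_boot all_order all_algebra.
From mathcomp Require Import all_classical all_reals all_analysis.
Set Implicit Arguments.
Unset Strict Implicit.
Unset Printing Implicit Defensive.
Import Order.TTheory GRing.Theory Num.Theory.
Import numFieldNormedType.Exports.
Local Open Scope classical_set_scope.
Local Open Scope ring_scope.

Section hardy.
Context {R : realType}.

Definition conj_exponent (p : R) : R := p / (p - 1).

(* The library's beta_fun only takes natural numbers as arguments. *)
Definition Beta (a b : R) : R :=
  \int[@lebesgue_measure R]_(x in `[0, 1]) (x `^ (a - 1) * (1 - x) `^ (b - 1)).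

Definition hardy_k (q p : R) : R :=
  if p == q then p `^ p^-1 * (conj_exponent p) `^ (conj_exponent p)^-1
  else let r := q / p - 1 in
       (r / Beta r^-1 ((q - 1) / r)) `^ (p^-1 - q^-1).

Local Open Scope ereal_scope.

(* Products use the convention 0 * +oo = 0. *)
Definition hardy_B (p q : R)
    (mu nu : {sigma_finite_measure set (measurableTypeR R) -> \bar R}) : \bar R :=
  ereal_sup [set nu `]-oo, x]%classic `^ (conj_exponent p)^-1
               * mu `[x, +oo[%classic `^ q^-1
            | x in [set: R]].

(* The inner integral is over I x, to be taken as ]-oo, x] or ]-oo, x[.
   When the positive and negative parts of f both have infinite nu-integral over
   I x, the inner integral is -oo and its absolute value +oo; such f do not
   affect the optimal constant, since replacing f by `|f| can only increase the
   left-hand side. *)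
Definition hardy_inequality (I : R -> set R) (p q : R)
    (mu nu : {sigma_finite_measure set (measurableTypeR R) -> \bar R})
    (A : \bar R) : Prop :=
  forall f : measurableTypeR R -> measurableTypeR R, measurable_fun setT f ->
    (\int[mu]_x (`| \int[nu]_(y in I x) (f y)%:E | `^ q)) `^ q^-1
    <= A * (\int[nu]_x (`| (f x)%:E | `^ p)) `^ p^-1.

Definition hardy_optimal (I : R -> set R) (p q : R)
    (mu nu : {sigma_finite_measure set (measurableTypeR R) -> \bar R}) : \bar R :=
  ereal_inf [set A | 0 <= A /\ hardy_inequality I p q mu nu A].

Definition no_common_atom
    (mu nu : {sigma_finite_measure set (measurableTypeR R) -> \bar R}) : Prop :=
  forall x : R, mu [set x] = 0 \/ nu [set x] = 0.

End hardy.

(* Main.v *)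
Require Import Defs.
From HB Require Import structures.
From mathcomp Require Import all_boot all_order all_algebra.
From mathcomp Require Import all_classical all_reals all_analysis.
From mathcomp Require Import measurable_realfun ring lra.
Set Implicit Arguments.
Unset Strict Implicit.
Unset Printing Implicit Defensive.
Import Order.TTheory GRing.Theory Num.Theory.
Import numFieldNormedType.Exports.
Local Open Scope classical_set_scope.
Local Open Scope ring_scope.

(** The lower bound tests the inequality on indicators of sets of finite
    [nu]-measure inside [(-oo, x]].

    For the upper bound, write [N x = nu (-oo, x]].  Bounding the primitive of [f]
    on any set of measure at most [s] by the integral [G s] of the decreasing
    rearrangement of [f] over [(0, s)], and [mu {N >= s}] by a power of [s] through
    the definition of [B], reduces everything to the one-dimensional inequality of
    Bliss for the increments of [G] along a geometric mesh of ratio [rho > 1], at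
    the price of a power of [rho], and [rho] tends to [1].

    In the scale-invariant variable [tau = G^p s^(1-p)] the extremals of Bliss's
    problem are the solutions of [v^(p-1) (1 - v) = lam tau^r] with [r = q/p - 1]
    and [v = s G'/G]: the variable [th = v^(p-1)] decreases from [1] to [0] while
    [tau] rises to its maximum and comes back to [0].  Choosing [lam] so that this
    maximum is the one of the given [tau], and following the branch with
    [th >= th_max] before the maximum and the other one after it, the function
    [th tau + int_th^1 T], where [T th] is the value of [tau] on the extremal,
    calibrates the cost.  Its total increment is the area [int_0^1 T], a Beta
    integral; the weighted AM-GM inequality then eliminates [lam] and gives the
    sharp constant.  When [p = q] the constant choice [v = 1 - 1/p] suffices. *)


(** * Tangent inequalities for powers *)

Lemma powR_tangent {R : realType} (c x y : R) : 1 < c -> 0 <= x -> 0 <= y ->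
  c * y `^ (c - 1) * x <= x `^ c + (c - 1) * y `^ c.
Proof.
move=> c1 x0 y0.
have c10 : 0 < c - 1 by rewrite subr_gt0.
have c0 : 0 < c by apply: lt_trans c1.
have := @conjugate_powR R x (y `^ (c - 1)) c (c / (c - 1)) x0 (powR_ge0 _ _) c0
  (divr_gt0 c0 c10).
rewrite -powRrM mulrCA divff ?gt_eqF// mulr1 => /(_ _)/wrap[].
  by field; rewrite !gt_eqF.
rewrite -(ler_pM2l c0) => /le_trans H.
rewrite -mulrA [_ * x]mulrC; apply: H.
by rewrite le_eqVlt; apply/orP; left; apply/eqP; field; rewrite !gt_eqF.
Qed.

Lemma powR_subr1 {R : realType} (x c : R) : 0 < x -> x `^ (c - 1) = x `^ c / x.
Proof. by move=> x0; rewrite powRB ?powRr1 ?ltW// (gt_eqF x0) implybT. Qed.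

(* Two tangent inequalities at the final slope [y' / t]: one for the cost of the
   increment and one for the convex function [(y, s) |-> y^p s^(1-p)]. *)
Lemma increment_cost {R : realType} (p w s t y y' : R) :
  1 < p -> 0 <= w -> 0 < s -> s < t -> 0 <= y -> y <= y' ->
  w `^ (p - 1) * (y' `^ p * t `^ (1 - p) - y `^ p * s `^ (1 - p))
    + (p - 1) * (w `^ (p - 1) * (1 - w)) * (y' `^ p * t `^ (1 - p)) * ((t - s) / t)
  <= (y' - y) `^ p * (t - s) `^ (1 - p).
Proof.
move=> p1 w0 s0 st y0 yy'.
have t0 := lt_trans s0 st.
have d0 : 0 < t - s by rewrite subr_gt0.
have y'0 := le_trans y0 yy'.
have p0 : 0 < p - 1 by rewrite subr_gt0.
have E z u : 0 <= z -> 0 < u -> z `^ p * u `^ (1 - p) = (z / u) `^ p * u.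
  move=> z0 u0.
  rewrite powRM// ?invr_ge0 1?ltW// -powR_inv1 1?ltW// -powRrM mulN1r -mulrA.
  by rewrite -{3}(powRr1 (ltW u0)) -powRD ?(gt_eqF u0) ?implybT// addrC.
rewrite !E ?subr_ge0//.
set X := y' / t.
have X0 : 0 <= X by rewrite divr_ge0 // ltW.
have y'E : y' = X * t by rewrite /X divfK// gt_eqF.
have dy0 : 0 <= y' - y by rewrite subr_ge0.
have H1 := @powR_tangent R p ((y' - y) / (t - s)) (w * X) p1
  (divr_ge0 dy0 (ltW d0)) (mulr_ge0 w0 X0).
have H2 := @powR_tangent R p (y / s) X p1 (divr_ge0 y0 (ltW s0)) X0.
have wp : w `^ p = w `^ (p - 1) * w by rewrite -mulr_powRB1 ?(lt_trans _ p1)// mulrC.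
have Xp : X `^ p = X `^ (p - 1) * X by rewrite -mulr_powRB1 ?(lt_trans _ p1)// mulrC.
rewrite !(powRM _ w0 X0) wp Xp in H1; rewrite !Xp in H2; rewrite Xp.
move: (powR_ge0 w (p - 1)) (powR_ge0 X (p - 1)) H1 H2.
set W := w `^ (p - 1); set Z := X `^ (p - 1).
set A := _ `^ p; set C := _ `^ p => W0 Z0.
move=> H1 H2.
rewrite -(ler_pM2r d0) in H1; rewrite -(ler_pM2r s0) in H2.
have E1 : p * (W * Z) * ((y' - y) / (t - s)) * (t - s) = p * (W * Z) * (y' - y).
  by field; rewrite gt_eqF.
have E2 : p * Z * (y / s) * s = p * Z * y by field; rewrite gt_eqF.
have -> : (p - 1) * (W * (1 - w)) * (Z * X * t) * ((t - s) / t)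
   = (p - 1) * (W * (1 - w)) * (Z * X) * (t - s) by field; rewrite gt_eqF.
rewrite E1 in H1; rewrite E2 in H2.
have {}H2 := ler_wpM2l W0 H2.
have y'X : Z * y' = Z * (X * t) by rewrite -y'E.
have {}y'X : W * (Z * y') = W * (Z * (X * t)) by rewrite y'X.
nra.
Qed.

(** * The profile of the extremals *)

(** The absolute value excludes negative bases, on which [powR] takes a default value, and with them
    a jump at [0]. *)
Lemma continuous_powR_norm {R : realType} (a : R) :
  0 < a -> continuous (fun x : R => `|x| `^ a).
Proof.
move=> a0 x; have [->|x0] := eqVneq x 0.
  apply/cvgrPdist_lt => e e0; rewrite normr0 powR0 ?gt_eqF//.
  near=> z; rewrite sub0r normrN norm_powR// normr_id.
  rewrite -[ltRHS](@powRr1 _ e) ?ltW// -(@mulVf _ a) ?gt_eqF// powRrM.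
  apply: gt0_ltr_powR; rewrite ?nnegrE ?powR_ge0//.
  near: z; apply: (@nbhs0_lt _ R); exact: powR_gt0.
apply: (@continuous_comp _ _ _ (@Num.norm R R) (fun y => y `^ a)).
  exact: norm_continuous.
apply/differentiable_continuous/derivable1_diffP.
by apply: ex_derive; apply: is_derive1_powR; rewrite normr_gt0.
Unshelve. all: by end_near. Qed.

Lemma within_continuous_powR {R : realType} (a : R) (A : set R) (f : R -> R) :
  0 < a -> (forall x, A x -> 0 <= f x) -> {within A, continuous f} ->
  {within A, continuous (fun x => f x `^ a)}.
Proof.
move=> a0 f0 cf.
apply: (@subspace_eq_continuous _ _ _ (fun x => `|f x| `^ a)).
  by move=> x /set_mem Ax /=; rewrite ger0_norm ?f0.
move=> x; apply: (@continuous_comp (subspace A) R R f (fun y : R => `|y| `^ a)) => /=.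
  exact: cf.
exact: continuous_powR_norm.
Qed.

Section profile.
Context {R : realType}.
Variable p : R.
Hypothesis p1 : 1 < p.

Let p0 : 0 < p. Proof. exact: lt_trans p1. Qed.
Let p10 : 0 < p - 1. Proof. by rewrite subr_gt0. Qed.
Let ce0 : 0 < p / (p - 1). Proof. exact: divr_gt0. Qed.
Let ce1 : 1 < p / (p - 1).
Proof. by rewrite ltr_pdivlMr// mul1r ltrBlDr ltrDl. Qed.

(* With [th = v^(p-1)], this is [v^(p-1) (1 - v)]. *)
Definition profile (th : R) := th - th `^ conj_exponent p.

(** The point where [profile] is maximal on [[0, 1]], not the maximal value; it corresponds to
    [v = 1 - 1/p]. *)
Definition profile_max : R := ((p - 1) / p) `^ (p - 1).

Lemma profile_powR w : 0 <= w -> profile (w `^ (p - 1)) = w `^ (p - 1) * (1 - w).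
Proof.
move=> w0; rewrite /profile /conj_exponent -powRrM mulrCA divff ?gt_eqF// mulr1.
by rewrite -(mulr_powRB1 w0 p0) mulrBr mulr1 [w * _]mulrC.
Qed.

Lemma profile_max_gt0 : 0 < profile_max.
Proof. by rewrite powR_gt0// divr_gt0. Qed.

Lemma profile_max_lt1 : profile_max < 1.
Proof.
apply: (@lt_le_trans _ _ (1 `^ (p - 1))); last by rewrite powR1.
apply: gt0_ltr_powR; rewrite ?nnegrE// ?divr_ge0 ?(ltW p10) ?(ltW p0)//.
by rewrite ltr_pdivrMr// mul1r ltrBlDr ltrDl.
Qed.

Lemma profile_maxE : profile profile_max = profile_max / p.
Proof.
rewrite /profile_max profile_powR ?divr_ge0 ?(ltW p10)// ?(ltW p0)//.
by congr (_ * _); field; rewrite gt_eqF.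
Qed.

Lemma profile_le th : 0 <= th -> profile th <= th.
Proof. by move=> th0; rewrite lerBlDr lerDl powR_ge0. Qed.

Lemma profile_ge0 th : 0 <= th <= 1 -> 0 <= profile th.
Proof.
move=> /andP[]; rewrite le_eqVlt => /predU1P[<- _|th0 th1].
  by rewrite /profile powR0 ?subrr// gt_eqF.
by rewrite subr_ge0 ge1r_powR ?th0// ltW.
Qed.

(** Concavity of [profile], as a tangent inequality. The slope changes sign at [profile_max], which
    yields the monotonicity on either side. *)
Let profile_le_tangent (x y : R) : 0 <= x -> 0 <= y ->
  profile y - profile x <= (1 - p / (p - 1) * x `^ (p - 1)^-1) * (y - x).
Proof.
move=> x0 y0; have := @powR_tangent R (p / (p - 1)) y x ce1 y0 x0.
rewrite /profile /conj_exponent -(mulr_powRB1 x0 ce0).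
have -> : p / (p - 1) - 1 = (p - 1)^-1 by field; rewrite gt_eqF.
have -> : p / (p - 1) = 1 + (p - 1)^-1 by field; rewrite gt_eqF.
lra.
Qed.

Lemma profile_homo (x y : R) : 0 <= x -> x <= y -> y <= profile_max ->
  profile x <= profile y.
Proof.
move=> x0 xy ym; have y0 := le_trans x0 xy.
rewrite -subr_le0; apply: le_trans (profile_le_tangent y0 x0) _.
rewrite mulr_ge0_le0 ?subr_le0// subr_ge0 -ler_pdivlMl// mulr1 invf_div.
have -> : (p - 1) / p = profile_max `^ (p - 1)^-1.
  by rewrite -powRrM divff ?gt_eqF// powRr1// divr_ge0// ltW.
by rewrite ge0_ler_powR ?nnegrE ?powR_ge0// invr_ge0 ltW.
Qed.

Lemma profile_nhomo (x y : R) : profile_max <= x -> x <= y -> profile y <= profile x.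
Proof.
move=> xm xy; have x0 : 0 <= x by apply: le_trans xm; rewrite ltW// profile_max_gt0.
have y0 := le_trans x0 xy.
rewrite -subr_le0; apply: le_trans (profile_le_tangent x0 y0) _.
rewrite mulr_le0_ge0 ?subr_ge0// subr_le0 -ler_pdivrMl// mulr1 invf_div.
have -> : (p - 1) / p = profile_max `^ (p - 1)^-1.
  by rewrite -powRrM divff ?gt_eqF// powRr1// divr_ge0// ltW.
by rewrite ge0_ler_powR ?nnegrE ?powR_ge0// invr_ge0 ltW.
Qed.

Lemma continuous_profile : {within `[0, 1], continuous profile}.
Proof.
have cid : {within `[(0 : R), 1], continuous (id : R -> R)}.
  by apply: continuous_subspaceT => z; exact: cvg_id.
have cpow := @within_continuous_powR R (conj_exponent p) _ _ ce0 _ cid.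
apply: (within_continuousB cid (cpow _)).
by move=> z /=; rewrite in_itv => /andP[].
Qed.

Let profile_max_in01 : 0 <= profile_max <= 1.
Proof. by rewrite !ltW ?profile_max_gt0 ?profile_max_lt1. Qed.

Lemma profile0 : profile 0 = 0.
Proof. by rewrite /profile powR0 ?subrr// gt_eqF. Qed.

Lemma profile1 : profile 1 = 0.
Proof. by rewrite /profile powR1 subrr. Qed.

(** With the next lemma, the two branches of the inverse of [profile], by the intermediate value
    theorem. *)
Lemma profile_surj_left v : 0 <= v <= profile profile_max ->
  exists2 th, 0 <= th <= profile_max & profile th = v.
Proof.
move=> v0; have /andP[m0 m1] := profile_max_in01.
have c : {within `[0, profile_max], continuous profile}.
  apply: continuous_subspaceW continuous_profile.
  by apply: subset_itv; rewrite !bnd_simp.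
case: (@IVT R profile 0 profile_max v m0 c).
  by rewrite profile0 min_l ?max_r ?profile_ge0 ?profile_max_in01.
by move=> th; rewrite in_itv; exists th.
Qed.

Lemma profile_surj_right v : 0 <= v <= profile profile_max ->
  exists2 th, profile_max <= th <= 1 & profile th = v.
Proof.
move=> v0; have /andP[m0 m1] := profile_max_in01.
have c : {within `[profile_max, 1], continuous profile}.
  apply: continuous_subspaceW continuous_profile.
  by apply: subset_itv; rewrite !bnd_simp.
case: (@IVT R profile profile_max 1 v m1 c).
  by rewrite profile1 min_r ?max_l ?profile_ge0 ?profile_max_in01.
by move=> th; rewrite in_itv; exists th.
Qed.

End profile.

(** * Integration of a derivative that is continuous only inside the interval *)

Section ftc_open.
Context {R : realType}.
Notation mu := (@lebesgue_measure R).

(* The integrand may blow up at the endpoints. *)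
Lemma ge0_continuous_FTC2_oo (f F : R -> R) (a b : R) : a < b ->
  {in `]a, b[, forall x, 0 <= f x} ->
  {in `]a, b[, continuous f} ->
  (forall x, x \in `]a, b[ -> is_derive x 1 F (f x)) ->
  {within `[a, b], continuous F} ->
  (\int[mu]_(x in `[a, b]) (f x)%:E = (F b - F a)%:E)%E.
Proof.
move=> ab f0 cf dF cF.
have mf : measurable_fun `]a, b[ f.
  apply: subspace_continuous_measurable_fun => //.
  by apply: continuous_in_subspaceT => x; rewrite inE/=; exact: cf.
(* The segments [D n] below exhaust the open interval; the factor [1 / 3] keeps [a + e n < b - e n]
   already at [n = 0], where [harmonic] is [1]. *)
pose e n : R := (b - a) / 3 * harmonic n.
have e0 n : 0 < e n by rewrite mulr_gt0 ?harmonic_gt0// divr_gt0// subr_gt0.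
have e1 n : e n <= (b - a) / 3.
  rewrite ler_piMr// ?divr_ge0 ?subr_ge0 ?(ltW ab)//.
  by rewrite /harmonic /= invf_le1// ler1n.
have ee n m : (n <= m)%N -> e m <= e n.
  move=> nm; rewrite ler_wpM2l ?divr_ge0 ?subr_ge0 ?(ltW ab)//.
  by rewrite /harmonic /= lef_pV2 ?posrE// ler_nat ltnS.
have elim : e @ \oo --> (0 : R).
  rewrite -(mulr0 ((b - a) / 3)); apply: cvgMr; exact: cvg_harmonic.
pose D n := `[a + e n, b - e n]%classic.
have DE : \bigcup_n D n = `]a, b[%classic.
  apply/seteqP; split => x.
    move=> [n _]; rewrite /D /= !in_itv/= => /andP[h1 h2].
    by apply/andP; split; have := e0 n; lra.
  rewrite /= in_itv/= => /andP[ax xb].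
  have m0 : 0 < Num.min (x - a) (b - x) by rewrite lt_min !subr_gt0 ax.
  have [n _ /(_ n (leqnn n))] : \forall n \near \oo, e n < Num.min (x - a) (b - x).
    by move/cvgrPdist_lt : elim => /(_ _ m0); apply: filterS => n;
       rewrite sub0r normrN gtr0_norm.
  rewrite /= lt_min => /andP[h1 h2]; exists n => //; rewrite /D/= in_itv/=.
  by apply/andP; split; lra.
have mfE : measurable_fun `]a, b[ (EFin \o f) by exact/measurable_EFinP.
rewrite (@integral_itv_bndoo _ _ _ (EFin \o f) true false)// -DE.
have Dab n : D n `<=` `]a, b[.
  by rewrite -DE; exact: bigcup_sup.
have cvgI : (\int[mu]_(x in D n) (f x)%:E @[n --> \oo] -->
     \int[mu]_(x in \bigcup_n D n) (f x)%:E)%E.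
  apply: ge0_nondecreasing_set_cvg_integral => //.
  - move=> n m nm; apply/subsetPset; apply: subset_itv; rewrite bnd_simp.
      by rewrite lerD2l ee.
    by rewrite lerB// ee.
  - by move=> n; exact: measurable_itv.
  - by move=> n; apply: measurable_funS mfE.
  - by move=> n x /Dab xab; rewrite lee_fin f0.
have cF' : {in `]a, b[, forall x, {for x, continuous F}}.
  move=> x xab; apply/differentiable_continuous/derivable1_diffP.
  by have [] := dF _ xab.
have sub n x : x \in `]a + e n, b - e n[ -> x \in `]a, b[.
  by rewrite !in_itv/= => /andP[h1 h2]; apply/andP; split; have := e0 n; lra.
have IE n : (\int[mu]_(x in D n) (f x)%:E = (F (b - e n) - F (a + e n))%:E)%E.
  have lt : a + e n < b - e n by have := e1 n; lra.
  rewrite (@continuous_FTC2 _ f F)//.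
  - apply: continuous_in_subspaceT => x; rewrite inE => /Dab; exact: cf.
  - split.
    + move=> x xD; by have [] := dF _ (sub _ _ xD).
    + apply: cvg_at_right_filter; apply: cF'.
      by rewrite in_itv/=; apply/andP; split; have := e0 n; lra.
    + apply: cvg_at_left_filter; apply: cF'.
      by rewrite in_itv/=; apply/andP; split; have := e0 n; lra.
  - move=> x xD; rewrite derive1E.
    by have [_ ->] := dF _ (sub _ _ xD).
have /(continuous_within_itvP _ ab)[_ Fa Fb] := cF.
have cb : F (b - e n) @[n --> \oo] --> F b.
  move/cvg_at_leftP : Fb; apply; split; first by move=> n; rewrite ltrBlDr ltrDl.
  by rewrite -[X in _ --> X](subr0 b); apply: cvgB => //; exact: cvg_cst.
have ca : F (a + e n) @[n --> \oo] --> F a.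
  move/cvg_at_rightP : Fa; apply; split; first by move=> n; rewrite ltrDl.
  by rewrite -[X in _ --> X](addr0 a); apply: cvgD => //; exact: cvg_cst.
rewrite (eq_cvg _ _ IE) in cvgI.
apply: (cvg_unique _ cvgI) => //.
by apply: cvg_EFin; [exact: nearW|]; apply: cvgB.
Qed.

End ftc_open.

Lemma within_continuousM {T : topologicalType} {K : numFieldType} (A : set T)
    (f g : T -> K) :
  {within A, continuous f} -> {within A, continuous g} ->
  {within A, continuous (f \* g)}.
Proof. by move=> cf cg x; apply: cvgM; [exact: cf|exact: cg]. Qed.

(** * The area under an extremal as a Beta integral *)

Section profile_area.
Context {R : realType}.
Variables p r : R.
Hypotheses (p1 : 1 < p) (r0 : 0 < r).

Let p10 : 0 < p - 1. Proof. by rewrite subr_gt0. Qed.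

Definition profile_area (th : R) : R :=
  \int[@lebesgue_measure R]_(t in `[0, th]) (profile p t `^ r^-1).

Let cT : {within `[0, 1], continuous (fun t => profile p t `^ r^-1)}.
Proof.
apply: within_continuous_powR; rewrite ?invr_gt0//; last exact: continuous_profile.
by move=> x /=; rewrite in_itv/=; exact: profile_ge0.
Qed.

Let iT : (@lebesgue_measure R).-integrable `[0, 1]
  (EFin \o (fun t => profile p t `^ r^-1)).
Proof. by apply: continuous_compact_integrable => //; exact: segment_compact. Qed.

Lemma profile_area0 : profile_area 0 = 0.
Proof. by rewrite /profile_area set_itv1 Rintegral_set1. Qed.

Lemma continuous_profile_area : {within `[0, 1], continuous profile_area}.
Proof. exact: (parameterized_integral_continuous ler01 iT). Qed.

Lemma is_derive_profile_area (x : R) : x \in `]0, 1[ ->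
  is_derive x 1 profile_area (profile p x `^ r^-1).
Proof.
move=> x01; have /andP[x0 x1] : 0 < x < 1 by move: x01; rewrite in_itv.
have cx : {for x, continuous (fun t => profile p t `^ r^-1)}.
  by have /(continuous_within_itvP _ ltr01)[+ _ _] := cT; exact.
have [d <-] := @continuous_FTC1_closed R (fun t => profile p t `^ r^-1) 0 x 1 x1 iT x0 cx.
by rewrite derive1E; exact: derivableP.
Qed.

Let is_derive_powR_onem (a x : R) : x \in `]0, 1[ ->
  is_derive x 1 (fun x : R => (1 - x) `^ a) (- (a * (1 - x) `^ (a - 1))).
Proof.
rewrite in_itv/= => /andP[x0 x1].
have d1 : is_derive x 1 (fun x : R => 1 - x) (- 1).
  by rewrite -[X in is_derive _ _ _ X]add0r; apply: is_deriveB.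
have d2 : is_derive (1 - x) 1 (fun y : R => y `^ a) (a * (1 - x) `^ (a - 1)).
  by apply: is_derive1_powR; rewrite subr_gt0.
rewrite -[- (a * _)]mulrN1.
exact: (@is_derive1_comp R (fun y : R => y `^ a) (fun x : R => 1 - x) x _ _ d2 d1).
Qed.

Let b := (p - 1) * (1 + r^-1).

Let b0 : 0 < b. Proof. by rewrite mulr_gt0// addr_gt0 ?invr_gt0. Qed.

(** The substitution [th = (1 - x)^(p-1)], for which [profile p th = (1 - x)^(p-1) x], and an
    integration by parts, merged into one function. The coefficient [r / (r + 1)] makes the terms in
    [x^(1/r) (1 - x)^(b-1)] of its derivative cancel. *)
Let primitive x : R :=
  r / (r + 1) * (x `^ r^-1 * (1 - x) `^ b) - profile_area ((1 - x) `^ (p - 1)).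

Let is_derive_primitive (x : R) : x \in `]0, 1[ ->
  is_derive x 1 primitive ((r + 1)^-1 * (x `^ (r^-1 - 1) * (1 - x) `^ b)).
Proof.
move=> x01; have /andP[x0 x1] : 0 < x < 1 by move: x01; rewrite in_itv.
have u0 : 0 < 1 - x by rewrite subr_gt0.
have u1 : 1 - x < 1 by rewrite ltrBlDr ltrDl.
have up01 : (1 - x) `^ (p - 1) \in `]0, 1[.
  rewrite in_itv/= powR_gt0//=.
  apply: (@lt_le_trans _ _ (1 `^ (p - 1))); last by rewrite powR1.
  by apply: gt0_ltr_powR => //; rewrite nnegrE ltW.
have d1 := is_derive1_powR r^-1 x0.
have d2 := is_derive_powR_onem b x01.
have d3 := @is_derive1_comp R profile_area (fun x : R => (1 - x) `^ (p - 1)) x _ _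
    (is_derive_profile_area up01) (is_derive_powR_onem (p - 1) x01).
have d4 := is_deriveB (is_deriveZ (r / (r + 1)) (is_deriveM d1 d2)) d3.
apply: is_derive_eq d4 _.
rewrite profile_powR ?(ltW u0)// subKr powRM ?powR_ge0 ?(ltW x0)//.
rewrite (powR_subr1 r^-1 x0) (powR_subr1 b u0) (powR_subr1 (p - 1) u0).
rewrite /GRing.scale /=.
have -> : (1 - x) `^ b = (1 - x) `^ (p - 1) * ((1 - x) `^ (p - 1)) `^ r^-1.
  rewrite -powRrM -powRD /b ?mulrDr ?mulr1//.
  by rewrite (gt_eqF u0) implybT.
rewrite /b; move: (x `^ _) (_ `^ (p - 1)) => A B; move: (B `^ _) => C; field.
by rewrite (gt_eqF x0) (gt_eqF u0) (gt_eqF r0) (gt_eqF (addr_gt0 r0 ltr01)).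
Qed.

Let continuous_primitive : {within `[0, 1], continuous primitive}.
Proof.
have [_ Y0 Y1] := (continuous_within_itvP _ ltr01).1 continuous_profile_area.
have cid : {within `[(0 : R), 1], continuous (id : R -> R)}.
  by apply: continuous_subspaceT => z; exact: cvg_id.
have conem : {within `[(0 : R), 1], continuous (fun x : R => 1 - x)}.
  by apply: continuous_subspaceT => z; apply: continuousB => //; exact: cvg_cst.
have onem_ge0 (x : R) : x \in `[0, 1] -> 0 <= 1 - x.
  by rewrite in_itv/= subr_ge0 => /andP[].
have /(continuous_within_itvP _ ltr01)[_ c0 c1] :=
  within_continuous_powR p10 onem_ge0 conem.
have dec : {in `[(0 : R), 1] &, {homo (fun x : R => (1 - x) `^ (p - 1)) : x y /~ x < y}}.
  move=> x y; rewrite !in_itv/= => /andP[x0 x1] /andP[y0 y1] xy.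
  by apply: gt0_ltr_powR; rewrite ?nnegrE ?subr_ge0// ltrD2l ltrN2.
apply: within_continuousB.
  apply: (@within_continuousM _ _ _ (cst (r / (r + 1)))).
    by apply: continuous_subspaceT => z; exact: cvg_cst.
  apply: within_continuousM; last exact: within_continuous_powR onem_ge0 conem.
  apply: within_continuous_powR cid; first by rewrite invr_gt0.
  by move=> z /=; rewrite in_itv/= => /andP[].
(* At the end points [profile_area] has one-sided limits only, and the strictly decreasing inner map
   exchanges left and right. *)
apply/(continuous_within_itvP _ ltr01); split.
- move=> x x01; apply/differentiable_continuous/derivable1_diffP.
  have up01 : (1 - x) `^ (p - 1) \in `]0, 1[.
    move: x01; rewrite !in_itv/= => /andP[x0 x1].
    rewrite powR_gt0 ?subr_gt0//=.
    apply: (@lt_le_trans _ _ (1 `^ (p - 1))); last by rewrite powR1.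
    by apply: gt0_ltr_powR; rewrite // ?nnegrE ?subr_ge0 ?(ltW x1)// ltrBlDr ltrDl.
  by have [] := @is_derive1_comp R profile_area (fun x : R => (1 - x) `^ (p - 1)) x _ _
    (is_derive_profile_area up01) (is_derive_powR_onem (p - 1) x01).
- apply: (@decreasing_cvg_at_right_comp _ (fun x => (1 - x) `^ (p - 1)) profile_area
     0 (BRight 1)) => //; first by rewrite bnd_simp.
  by rewrite subr0 powR1.
- apply: (@decreasing_cvg_at_left_comp _ (fun x => (1 - x) `^ (p - 1)) profile_area
     (BLeft 0) 1) => //; first by rewrite bnd_simp.
  by rewrite subrr powR0 ?gt_eqF.
Qed.

(** The fundamental theorem applied to [primitive], which vanishes at [1] and is [- profile_area 1]
    at [0]. For [r > 1] the integrand blows up at [0]. *)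
Lemma Beta_profile_area :
  Beta r^-1 ((p * (r + 1) - 1) / r) = (r + 1) * profile_area 1.
Proof.
have rr : 0 < r + 1 by rewrite addr_gt0.
have -> : (p * (r + 1) - 1) / r = b + 1 by rewrite /b; field; rewrite gt_eqF.
rewrite /Beta addrK.
have mB : measurable_fun `[(0 : R), 1] (fun x : R => x `^ (r^-1 - 1) * (1 - x) `^ b).
  apply: measurable_funM.
    apply: measurable_funTS; exact: measurable_powR.
  apply: measurable_funTS; apply: (@measurableT_comp _ _ _ _ _ _ (fun y : R => y `^ b)).
    exact: measurable_powR.
  exact: measurable_funB.
pose g (x : R) := (r + 1)^-1 * (x `^ (r^-1 - 1) * (1 - x) `^ b).
have g0 : {in `]0, 1[, forall x, 0 <= g x}.
  by move=> x x01; rewrite !mulr_ge0 ?powR_ge0// invr_ge0 ltW.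
have cg : {in `]0, 1[, continuous g}.
  move=> x x01; have /andP[x0 x1] : 0 < x < 1 by move: x01; rewrite in_itv.
  apply/differentiable_continuous/derivable1_diffP.
  by have [] := is_deriveZ (r + 1)^-1 (is_deriveM (is_derive1_powR (r^-1 - 1) x0)
    (is_derive_powR_onem b x01)).
have E := ge0_continuous_FTC2_oo ltr01 g0 cg is_derive_primitive continuous_primitive.
have P01 : primitive 1 - primitive 0 = profile_area 1.
  have h0 a : 0 < a -> (0 : R) `^ a = 0 by move=> a0; rewrite powR0 ?gt_eqF.
  have h1 a : (1 : R) `^ a = 1 by rewrite powR1.
  have p1E : primitive 1 = 0.
    by rewrite /primitive subrr (h0 _ p10) (h0 _ b0) profile_area0 !mulr0 subrr.
  have p0E : primitive 0 = - profile_area 1.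
    by rewrite /primitive subr0 h1 (h0 r^-1) ?invr_gt0// mul0r mulr0 h1 sub0r.
  by rewrite p1E p0E sub0r opprK.
rewrite P01 in E.
rewrite /Rintegral.
have gE x : x `^ (r^-1 - 1) * (1 - x) `^ b = (r + 1) * g x.
  by rewrite /g mulrA divff ?mul1r ?gt_eqF.
under eq_integral do rewrite gE EFinM.
rewrite ge0_integralZl_EFin ?E ?(ltW rr)//.
- by move=> x _; rewrite lee_fin !mulr_ge0 ?powR_ge0// invr_ge0 ltW.
- by apply/measurable_EFinP; apply: measurable_funM => //; exact: mB.
Qed.

(** By the mean value theorem the area is a value of the integrand at an interior point, where
    [profile] is positive. *)
Lemma profile_area_gt0 : 0 < profile_area 1.
Proof.
have [c c01] := @MVT R profile_area (fun x => profile p x `^ r^-1) 0 1 ltr01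
  is_derive_profile_area continuous_profile_area.
rewrite profile_area0 !subr0 mulr1 => ->; apply: powR_gt0.
move: c01; rewrite in_itv/= => /andP[c0 c1].
rewrite subr_gt0; rewrite -[ltRHS](powRr1 (ltW c0)).
rewrite /powR gt_eqF// ltr_expR ltr_nM2r ?ln_lt0 ?c0//.
by rewrite /conj_exponent ltr_pdivlMr// mul1r ltrBlDr ltrDl.
Qed.

End profile_area.

(** * The discrete Bliss inequality *)

(** Divided by [rho^a], this is [1 - rho^(-a) <= a (rho - 1)], from [expR x >= 1 + x] and
    [ln rho <= rho - 1]. *)
Lemma powR_sub1_le {R : realType} (rho a : R) : 1 < rho -> 0 <= a ->
  rho `^ a - 1 <= a * (rho - 1) * rho `^ a.
Proof.
move=> rho1 a0; have rho0 : 0 < rho by apply: lt_trans rho1.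
have lnrho : ln rho <= rho - 1.
  by have := @le_ln1Dx R (rho - 1); rewrite subrKC; apply; lra.
have : 1 - a * (rho - 1) <= rho `^ (- a).
  apply: (@le_trans _ _ (1 - a * ln rho)); first by rewrite lerD2l lerN2 ler_wpM2l.
  rewrite /powR gt_eqF// mulNr; exact: expR_ge1Dx.
rewrite -(ler_pM2r (powR_gt0 a rho0)) powRN mulVf ?gt_eqF ?powR_gt0//.
lra.
Qed.

(* Weighted AM-GM, in the form that eliminates the multiplier [lam]. *)
Lemma multiplier_elimination {R : realType} (r lam c b M E : R) :
  0 < r -> 0 < lam -> 0 <= b -> 0 <= M -> c = lam `^ (- r^-1) ->
  c * b + lam * M <= (r + 1) * E -> (b / r) `^ r * M <= E `^ (r + 1).
Proof.
move=> r0 lam0 b0 M0 cE H.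
have s0 : 0 < r + 1 by rewrite addr_gt0.
have c0 : 0 < c by rewrite cE powR_gt0.
have br0 : 0 <= b / r by rewrite divr_ge0// ltW.
(* With weights [r / (r + 1)] and [1 / (r + 1)] the mean of [A] and [B] is at most [E], while [lam]
   drops out of [A]^ r * B[because]c [^ r = lam^-1]. *)
set A := c * (b / r); set B := lam * M.
have A0 : 0 <= A by rewrite mulr_ge0// ltW.
have B0 : 0 <= B by rewrite mulr_ge0// ltW.
have := @conjugate_powR R (A `^ (r / (r + 1))) (B `^ (r + 1)^-1)
  ((r + 1) / r) (r + 1) (powR_ge0 _ _) (powR_ge0 _ _) (divr_gt0 s0 r0) s0.
rewrite -!powRrM mulVf ?gt_eqF// powRr1//.
have -> : r / (r + 1) * ((r + 1) / r) = 1 by field; rewrite !gt_eqF.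
rewrite powRr1// => /(_ _)/wrap[]; first by field; rewrite !gt_eqF.
move=> AB.
have {}AB : A `^ (r / (r + 1)) * B `^ (r + 1)^-1 <= E.
  apply: le_trans AB _; rewrite -(ler_pM2l s0); apply: le_trans H.
  by rewrite le_eqVlt; apply/orP; left; apply/eqP; rewrite /A /B; field; rewrite !gt_eqF.
have E0 : 0 <= E by apply: le_trans AB; rewrite mulr_ge0 ?powR_ge0.
have := @ge0_ler_powR R (r + 1) (ltW s0) _ _ _ _ AB.
rewrite !nnegrE mulr_ge0 ?powR_ge0// => /(_ isT E0).
rewrite powRM ?powR_ge0// -!powRrM mulVf ?gt_eqF// powRr1//.
have -> : r / (r + 1) * (r + 1) = r by field; rewrite gt_eqF.
apply: le_trans; rewrite /A /B [(c * _) `^ r]powRM ?(ltW c0)// cE -powRrM mulNr mulVf ?gt_eqF//.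
rewrite powR_inv1 ?(ltW lam0)//.
by rewrite le_eqVlt; apply/orP; left; apply/eqP; field; rewrite gt_eqF.
Qed.

(** * Tangent bounds for the area function *)

Section area_bounds.
Context {R : realType}.
Variables p r : R.
Hypotheses (p1 : 1 < p) (r0 : 0 < r).
Local Notation Y := (profile_area p r).
Local Notation thM := (profile_max p).

Let thM0 : 0 < thM. Proof. exact: profile_max_gt0. Qed.
Let thM1 : thM < 1. Proof. exact: profile_max_lt1. Qed.
Let ri0 : 0 <= r^-1. Proof. by rewrite invr_ge0 ltW. Qed.

Let profile_in x : 0 <= x <= 1 -> profile p x \is Num.nneg.
Proof. by move=> x01; rewrite nnegrE profile_ge0. Qed.

Let MVT_area (x y : R) : 0 <= x -> x < y -> y <= 1 ->
  exists2 z, x < z < y & Y y - Y x = profile p z `^ r^-1 * (y - x).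
Proof.
move=> x0 xy y1.
have cY : {within `[x, y], continuous Y}.
  apply: continuous_subspaceW (continuous_profile_area p1 r0).
  by apply: subset_itv; rewrite bnd_simp.
have dY z : z \in `]x, y[ -> is_derive z 1 Y (profile p z `^ r^-1).
  rewrite in_itv/= => /andP[xz zy]; apply: (is_derive_profile_area p1 r0).
  by rewrite in_itv/= (le_lt_trans x0 xz) (lt_le_trans zy y1).
by have [z] := MVT xy dY cY; rewrite in_itv/=; exists z.
Qed.

(** To the right of [thM] the derivative of [Y] decreases, so [Y] is concave and lies below its
    tangents. *)
Lemma profile_area_le_right (x y : R) : thM <= x <= 1 -> thM <= y <= 1 ->
  Y y - Y x <= profile p x `^ r^-1 * (y - x).
Proof.
move=> /andP[Mx x1] /andP[My y1].
have x0 := le_trans (ltW thM0) Mx; have y0 := le_trans (ltW thM0) My.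
have [xy|yx|->] := ltgtP x y; last by rewrite !subrr mulr0.
- have [z /andP[xz zy] ->] := MVT_area x0 xy y1.
  apply: ler_wpM2r; first by rewrite subr_ge0 ltW.
  apply: ge0_ler_powR => //.
  + by rewrite profile_in ?(le_trans x0 (ltW xz)) ?(le_trans (ltW zy)).
  + by rewrite profile_in ?x0.
  + exact: (profile_nhomo p1 Mx (ltW xz)).
- have [z /andP[yz zx] H] := MVT_area y0 yx x1.
  rewrite -lerN2 opprB -mulrN opprB H.
  apply: ler_wpM2r; first by rewrite subr_ge0 ltW.
  apply: ge0_ler_powR => //.
  + by rewrite profile_in ?x0.
  + by rewrite profile_in ?(le_trans y0 (ltW yz)) ?(le_trans (ltW zx)).
  + exact: (profile_nhomo p1 (le_trans My (ltW yz)) (ltW zx)).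
Qed.

(** To the left of [thM] the derivative increases, and the convex function [Y] lies above its
    tangents. *)
Lemma profile_area_ge_left (x y : R) : 0 <= x <= thM -> 0 <= y <= thM ->
  profile p x `^ r^-1 * (y - x) <= Y y - Y x.
Proof.
move=> /andP[x0 xM] /andP[y0 yM].
have x1 := le_trans xM (ltW thM1); have y1 := le_trans yM (ltW thM1).
have [xy|yx|->] := ltgtP x y; last by rewrite !subrr mulr0.
- have [z /andP[xz zy] ->] := MVT_area x0 xy y1.
  apply: ler_wpM2r; first by rewrite subr_ge0 ltW.
  apply: ge0_ler_powR => //.
  + by rewrite profile_in ?x0.
  + by rewrite profile_in ?(le_trans x0 (ltW xz)) ?(le_trans (ltW zy)).
  + exact: (profile_homo p1 x0 (ltW xz) (le_trans (ltW zy) yM)).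
- have [z /andP[yz zx] H] := MVT_area y0 yx x1.
  rewrite -lerN2 opprB -mulrN opprB H.
  apply: ler_wpM2r; first by rewrite subr_ge0 ltW.
  apply: ge0_ler_powR => //.
  + by rewrite profile_in ?(le_trans y0 (ltW yz)) ?(le_trans (ltW zx)).
  + by rewrite profile_in ?x0.
  + exact: (profile_homo p1 (le_trans y0 (ltW yz)) (ltW zx) xM).
Qed.

(** The integrated form of [profile p t <= t], by the mean value theorem for the difference [D]; it
    closes the calibration at the last node. *)
Lemma profile_area_le (x : R) : 0 <= x <= 1 ->
  Y x <= r / (r + 1) * (x * x `^ r^-1).
Proof.
move=> /andP[x0 x1]; move: x0; rewrite le_eqVlt => /predU1P[<-|x0].
  by rewrite profile_area0 mul0r mulr0.
pose D := (fun y : R => r / (r + 1) * y `^ (1 + r^-1) - Y y).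
have ri1 : 0 < 1 + r^-1 by rewrite ltr_wpDr.
have dD z : z \in `]0, x[ -> is_derive z 1 D (z `^ r^-1 - profile p z `^ r^-1).
  rewrite in_itv/= => /andP[z0 zx].
  have z01 : z \in `]0, 1[ by rewrite in_itv/= z0 (lt_le_trans zx).
  have := is_deriveB (is_deriveZ (r / (r + 1)) (is_derive1_powR (1 + r^-1) z0))
    (is_derive_profile_area p1 r0 z01).
  move=> H; apply: is_derive_eq H _; rewrite addrAC subrr add0r /GRing.scale/=.
  by congr (_ - _); field; rewrite !gt_eqF// addr_gt0.
have cD : {within `[0, x], continuous D}.
  apply: within_continuousB.
    apply: (@within_continuousM _ _ _ (cst (r / (r + 1)))).
      by apply: continuous_subspaceT => z; exact: cvg_cst.
    apply: within_continuous_powR => //.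
      by move=> z /=; rewrite in_itv/= => /andP[].
    by apply: continuous_subspaceT => z; exact: cvg_id.
  apply: continuous_subspaceW (continuous_profile_area p1 r0).
  by apply: subset_itv; rewrite bnd_simp.
have [z] := MVT x0 dD cD; rewrite in_itv/= => /andP[z0 zx].
rewrite /D profile_area0 powR0 ?gt_eqF// mulr0 !subr0 => H.
have xE : x `^ (1 + r^-1) = x * x `^ r^-1.
  by rewrite powRD ?(gt_eqF x0) ?implybT// powRr1// ltW.
rewrite -xE -subr_ge0 H mulr_ge0 ?(ltW x0)// subr_ge0 ge0_ler_powR//.
- by rewrite profile_in ?(ltW z0) ?(le_trans (ltW zx)).
- by rewrite nnegrE ltW.
- by rewrite profile_le// ltW.
Qed.

End area_bounds.

(** * Calibration of the cost along a finite sequence *)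

Section discrete_bliss.
Context {R : realType}.
(* The lower bounds on [cost] are those of [increment_cost], with [th = w^(p-1)]. *)
Variables (p q rho : R) (tau cost : nat -> R) (n : nat).
Hypotheses (p1 : 1 < p) (rho1 : 1 < rho).
Hypothesis tau_ge0 : forall i, 0 <= tau i.
Hypothesis tau_growth : forall i, tau i.+1 <= rho * tau i.
Hypothesis cost_ge : forall i th, 0 <= th ->
  th * (tau i.+1 - tau i)
    + (p - 1) * profile p th * tau i.+1 * ((rho - 1) / rho) <= cost i.

Let p0 : 0 < p. Proof. exact: lt_trans p1. Qed.
Let p10 : 0 < p - 1. Proof. by rewrite subr_gt0. Qed.
Let rho0 : 0 < rho. Proof. exact: lt_trans rho1. Qed.
Let rho10 : 0 < rho - 1. Proof. by rewrite subr_gt0. Qed.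

(** The case [p = q]: [cost_ge] is summed at the constant [th = profile_max p], where
    [profile p th = th / p], and the increments of [tau] telescope. The left-hand side has the form
    that [mesh_sum_le] produces by summation by parts. *)
Lemma discrete_hardy :
  tau n + (rho `^ (p - 1) - 1) * \sum_(i < n) tau i.+1 <=
    rho `^ p * (p / profile_max p) * (tau 0%N + \sum_(i < n) cost i).
Proof.
set th := profile_max p; set S := \sum_(i < n) tau i.+1.
have th0 : 0 < th by exact: profile_max_gt0.
have th1 : th < 1 by exact: profile_max_lt1.
have S0 : 0 <= S by apply: sumr_ge0.
have H : th * tau n + (p - 1) * (th / p) * ((rho - 1) / rho) * S
    <= tau 0%N + \sum_(i < n) cost i.
  have : \sum_(i < n) (th * (tau i.+1 - tau i)
      + (p - 1) * (th / p) * ((rho - 1) / rho) * tau i.+1) <= \sum_(i < n) cost i.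
    apply: ler_sum => i _; apply: le_trans (cost_ge i (ltW th0)).
    by rewrite profile_maxE// -/th mulrAC.
  rewrite big_split/= -!mulr_sumr -/S.
  rewrite -(big_mkord xpredT (fun i => tau i.+1 - tau i)) telescope_sumr//.
  have : th * tau 0%N <= tau 0%N by rewrite ler_piMl// ltW.
  lra.
have rp0 : 0 < rho `^ (p - 1) by exact: powR_gt0.
have rp : rho `^ p = rho `^ (p - 1) * rho by rewrite -mulr_powRB1 ?(ltW rho0)// mulrC.
have rp1 : 1 <= rho `^ p by rewrite -(powRr0 rho) ler_powR// ltW.
have c0 : 0 < rho `^ p * (p / th) by rewrite mulr_gt0 ?divr_gt0// powR_gt0.
move: H; rewrite -(ler_pM2l c0); apply: le_trans.
rewrite mulrDr; apply: lerD.
  rewrite [leRHS](_ : _ = rho `^ p * p * tau n); last by field; rewrite gt_eqF.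
  rewrite -[leLHS]mul1r ler_wpM2r//.
  by rewrite -[leLHS]mulr1 ler_pM// ltW.
rewrite [leRHS](_ : _ = (p - 1) * (rho - 1) * rho `^ (p - 1) * S).
  rewrite ler_wpM2r//; exact: (powR_sub1_le rho1 (ltW p10)).
by rewrite rp; field; rewrite !gt_eqF.
Qed.

Variable r : R.
Hypotheses (r0 : 0 < r) (qE : q = p * (r + 1)).
Let Q0 : 0 < r + 1. Proof. by rewrite addr_gt0. Qed.
Let q0 : 0 < q. Proof. by rewrite qE mulr_gt0. Qed.
Local Notation Y := (profile_area p r).
Local Notation thM := (profile_max p).

(* [th i] follows the branch of [profile p] to the right of its maximum up to the
   index [j] where [tau] is largest, and the branch to the left afterwards. *)
Let branches (lam : R) (j : nat) : (j <= n)%N -> 0 < lam ->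
  (forall i, (i <= n)%N -> tau i <= tau j) -> lam * tau j `^ r = profile p thM ->
  exists th : nat -> R, forall i, (i <= n)%N ->
    [/\ 0 <= th i <= 1, profile p (th i) = lam * tau i `^ r,
      ((i <= j)%N -> thM <= th i) & ((j <= i)%N -> th i <= thM)].
Proof.
move=> jn lam0 jmax lamE.
have M0 := profile_max_gt0 p1; have M1 := profile_max_lt1 p1.
suff /choice[th H] : forall i, exists x, (i <= n)%N ->
    [/\ 0 <= x <= 1, profile p x = lam * tau i `^ r,
      ((i <= j)%N -> thM <= x) & ((j <= i)%N -> x <= thM)] by exists th.
move=> i; have [ni|ni] := leqP i n; last by exists 0.
have ran : 0 <= lam * tau i `^ r <= profile p thM.
  rewrite mulr_ge0 ?powR_ge0 ?(ltW lam0)//= -lamE ler_wpM2l ?(ltW lam0)//.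
  by apply: ge0_ler_powR; rewrite ?nnegrE ?(ltW r0)//; exact: jmax.
have [ij|ji|ij] := ltngtP i j.
- have [x /andP[x0 x1] xE] := profile_surj_right p1 ran.
  by exists x => _; split; rewrite ?x1 ?(le_trans (ltW M0) x0)//.
- have [x /andP[x0 x1] xE] := profile_surj_left p1 ran.
  by exists x => _; split; rewrite ?x0 ?(le_trans x1 (ltW M1))//.
- by exists thM => _; split; rewrite ?(ltW M0) ?(ltW M1)// ij.
Qed.

(* [(r + 1) * Y 1] is the Beta integral, see [Beta_profile_area]. *)
Lemma discrete_bliss :
  tau n `^ (r + 1) + (rho `^ (q - (r + 1)) - 1) * \sum_(i < n) tau i.+1 `^ (r + 1) <=
    rho `^ q * (r / ((r + 1) * Y 1)) `^ r
      * (tau 0%N + \sum_(i < n) cost i) `^ (r + 1).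
Proof.
pose j : nat := [arg max_(i > ord0 : 'I_n.+1) tau i]%O.
have [jn jmax] : (j <= n)%N /\ forall i, (i <= n)%N -> tau i <= tau j.
  rewrite /j; case: arg_maxP => //= i _ H; split; first by rewrite -ltnS.
  by move=> k; rewrite -ltnS => kn; exact: (H (Ordinal kn)).
have [tj0|tj0] := eqVneq (tau j) 0.
  have t0 i : (i <= n)%N -> tau i `^ (r + 1) = 0.
    move=> ni; have -> : tau i = 0.
      by apply/eqP; rewrite eq_le tau_ge0 -tj0 jmax.
    by rewrite powR0// gt_eqF.
  rewrite t0// big1 ?mulr0 ?addr0 ?mulr_ge0 ?powR_ge0//.
  by move=> i _; rewrite t0.
have tj : 0 < tau j by rewrite lt_neqAle eq_sym tj0 tau_ge0.
have M0 := profile_max_gt0 p1; have M1 := profile_max_lt1 p1.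
have H0 : 0 < profile p thM by rewrite profile_maxE// divr_gt0.
(* The multiplier of the extremal whose maximum is [tau j]. *)
pose lam := profile p thM / tau j `^ r.
have lam0 : 0 < lam by rewrite divr_gt0// powR_gt0.
have lamE : lam * tau j `^ r = profile p thM by rewrite /lam divfK// gt_eqF// powR_gt0.
have [th thP] := branches jn lam0 jmax lamE.
pose c := lam `^ (- r^-1).
have c0 : 0 < c by rewrite powR_gt0.
have cE x : 0 <= x -> c * (lam * x `^ r) `^ r^-1 = x.
  move=> x0; rewrite powRM ?powR_ge0 ?(ltW lam0)// -powRrM divff ?gt_eqF// powRr1//.
  by rewrite mulrA /c powRN mulVf ?mul1r// gt_eqF// powR_gt0.
pose Psi i := th i * tau i + c * (Y 1 - Y (th i)).
set S := \sum_(i < n) tau i.+1 `^ (r + 1).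
set E := tau 0%N + _.
have tauQ i : tau i `^ r * tau i = tau i `^ (r + 1).
  by have := @mulr_powRB1 R (tau i) (r + 1) (tau_ge0 i) Q0; rewrite addrK mulrC.
have step i : (i < n)%N -> Psi i.+1 - Psi i
    + (p - 1) * lam * rho `^ (- r) * ((rho - 1) / rho) * tau i.+1 `^ (r + 1) <= cost i.
  move=> ni.
  have [/andP[a0 a1] aE aR aL] := thP i (ltnW ni).
  have [/andP[b0 b1] bE bR bL] := thP i.+1 ni.
  have growth : rho `^ (- r) * tau i.+1 `^ r <= tau i `^ r.
    rewrite powRN ler_pdivrMl ?powR_gt0// -powRM ?(ltW rho0)//.
    by apply: ge0_ler_powR; rewrite ?nnegrE ?mulr_ge0 ?(ltW r0) ?(ltW rho0).
  have rhom : rho `^ (- r) <= 1.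
    by rewrite -[leRHS](powRr0 rho) ler_powR ?(ltW rho1)// oppr_le0 ltW.
  have D0 : 0 <= (p - 1) * lam * ((rho - 1) / rho).
    by apply: ltW; apply: mulr_gt0; [exact: mulr_gt0|exact: divr_gt0].
  have [ij|ji] := ltnP i j.
  - apply: le_trans (cost_ge i a0); apply: lerD.
      have := profile_area_le_right p1 r0 (x := th i.+1) (y := th i).
      rewrite bR// b1 aR ?(ltnW ij)// a1 bE => /(_ isT isT)/(ler_wpM2l (ltW c0)).
      rewrite [X in _ <= X -> _]mulrA cE// /Psi.
      lra.
    rewrite aE -tauQ.
    rewrite [leLHS](_ : _ = (p - 1) * lam * ((rho - 1) / rho) * tau i.+1
       * (rho `^ (- r) * tau i.+1 `^ r)); last by ring.
    rewrite [leRHS](_ : _ = (p - 1) * lam * ((rho - 1) / rho) * tau i.+1 * tau i `^ r);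
      last by ring.
    by rewrite ler_wpM2l// mulr_ge0.
  - apply: le_trans (cost_ge i b0); apply: lerD.
      have := profile_area_ge_left p1 r0 (x := th i) (y := th i.+1).
      rewrite a0 aL// b0 bL ?(leqW ji)// aE => /(_ isT isT)/(ler_wpM2l (ltW c0)).
      rewrite [X in X <= _ -> _]mulrA cE// /Psi.
      lra.
    rewrite bE -tauQ.
    rewrite [leLHS](_ : _ = (p - 1) * lam * ((rho - 1) / rho) * tau i.+1
       * (rho `^ (- r) * tau i.+1 `^ r)); last by ring.
    rewrite [leRHS](_ : _ = (p - 1) * lam * ((rho - 1) / rho) * tau i.+1 * tau i.+1 `^ r);
      last by ring.
    by apply: ler_wpM2l; [exact: mulr_ge0|rewrite ler_piMl ?powR_ge0].
(* The tangent at [th 0], evaluated at [1]. *)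
have start : Psi 0%N <= tau 0%N.
  have [/andP[a0 a1] aE aR _] := thP 0%N (leq0n _).
  have := profile_area_le_right p1 r0 (x := th 0%N) (y := 1).
  rewrite aR// a1 (ltW M1) lexx aE => /(_ isT isT)/(ler_wpM2l (ltW c0)).
  rewrite [X in _ <= X -> _]mulrA cE// /Psi.
  lra.
have finish : c * Y 1 + (r + 1)^-1 * (lam * tau n `^ (r + 1)) <= Psi n.
  have [/andP[a0 a1] aE aR aL] := thP n (leqnn _).
  have t0 : 0 <= lam * tau n `^ r by rewrite mulr_ge0 ?powR_ge0// ltW.
  have tth : lam * tau n `^ r <= th n by rewrite -aE profile_le.
  have := profile_area_ge_left p1 r0 (x := th n) (y := lam * tau n `^ r).
  rewrite a0 aL// t0 (le_trans tth (aL jn)) aE => /(_ isT isT)/(ler_wpM2l (ltW c0)).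
  rewrite [X in X <= _ -> _]mulrA cE// /Psi.
  have := profile_area_le p1 r0 (x := lam * tau n `^ r).
  rewrite t0 (le_trans tth)// => /(_ isT)/(ler_wpM2l (ltW c0)).
  rewrite [X in _ <= X -> _](_ : _ = r / (r + 1) * (lam * tau n `^ r)
    * (c * (lam * tau n `^ r) `^ r^-1)); last by ring.
  rewrite cE// -tauQ.
  have -> : r / (r + 1) = 1 - (r + 1)^-1 by field; rewrite gt_eqF.
  lra.
have total : c * Y 1 + (r + 1)^-1 * (lam * tau n `^ (r + 1))
   + (p - 1) * lam * rho `^ (- r) * ((rho - 1) / rho) * S <= E.
  have : \sum_(i < n) (Psi i.+1 - Psi i
      + (p - 1) * lam * rho `^ (- r) * ((rho - 1) / rho) * tau i.+1 `^ (r + 1))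
     <= \sum_(i < n) cost i by apply: ler_sum => i _; exact: step.
  rewrite big_split/= -mulr_sumr -/S.
  rewrite -(big_mkord xpredT (fun i => Psi i.+1 - Psi i)) telescope_sumr//.
  by rewrite /E; lra.
set M := tau n `^ _ + _.
have S0 : 0 <= S by apply: sumr_ge0 => i _; exact: powR_ge0.
have kap0 : 0 <= q - (r + 1).
  by rewrite subr_ge0 qE ler_peMl// ltW.
(* The factor [rho]^ (- q)[absorbs the passage from the increment]rho [^ (q - (r + 1)) - 1] to its
   first-order form. *)
have ME : rho `^ (- q) * M <=
    tau n `^ (r + 1) + (q - (r + 1)) * rho `^ (- r) * ((rho - 1) / rho) * S.
  rewrite /M mulrDr; apply: lerD.
    by rewrite ler_piMl ?powR_ge0// -[leRHS](powRr0 rho) ler_powR ?(ltW rho1)// oppr_le0 ltW.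
  rewrite mulrA ler_wpM2r//.
  have -> : rho `^ (- r) = rho `^ (- q) * rho `^ (q - (r + 1)) * rho.
    rewrite -{4}(powRr1 (ltW rho0)) -!powRD ?(gt_eqF rho0) ?implybT//.
    by congr (_ `^ _); ring.
  rewrite [leRHS](_ : _ = rho `^ (- q) * ((q - (r + 1)) * (rho - 1) * rho `^ (q - (r + 1)))).
    by rewrite ler_wpM2l ?powR_ge0// powR_sub1_le.
  by field; rewrite gt_eqF.
have M0' : 0 <= M.
  rewrite addr_ge0 ?powR_ge0 ?mulr_ge0// subr_ge0 -[leLHS](powRr0 rho).
  by rewrite ler_powR// ltW.
have Y0 := profile_area_gt0 p1 r0.
have := @multiplier_elimination R r lam c ((r + 1) * Y 1) (rho `^ (- q) * M) E
  r0 lam0 (mulr_ge0 (ltW Q0) (ltW Y0)) (mulr_ge0 (powR_ge0 _ _) M0') erefl.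
have -> : c * ((r + 1) * Y 1) + lam * (rho `^ (- q) * M) <= (r + 1) * E.
  have := ler_wpM2l (ltW lam0) ME.
  have p1E : p - 1 = (q - (r + 1)) / (r + 1) by rewrite qE; field; rewrite gt_eqF.
  have := ler_wpM2l (ltW Q0) total.
  rewrite [X in X <= _ -> _](_ : _ = c * ((r + 1) * Y 1) + lam * (tau n `^ (r + 1) +
     (q - (r + 1)) * rho `^ (- r) * ((rho - 1) / rho) * S)).
    lra.
  by rewrite p1E; field; rewrite !gt_eqF.
move=> /(_ isT).
set W := (r + 1) * Y 1.
have W0 : 0 < W by rewrite mulr_gt0.
have k0 : 0 < rho `^ q * (r / W) `^ r by rewrite mulr_gt0 ?powR_gt0// divr_gt0.
rewrite -(ler_pM2l k0); apply: le_trans.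
rewrite [leRHS](_ : _ = (rho `^ q * rho `^ (- q)) * ((r / W) `^ r * (W / r) `^ r) * M);
  last by ring.
rewrite powRN mulfV ?gt_eqF ?powR_gt0// -powRM ?divr_ge0 ?(ltW r0) ?(ltW W0)//.
have -> : r / W * (W / r) = 1 by field; rewrite !gt_eqF.
by rewrite powR1 !mul1r.
Qed.

End discrete_bliss.

(** * Rearrangement along a geometric mesh *)

Section excess.
Local Open Scope ereal_scope.
Context d (T : measurableType d) (R : realType) (nu : {measure set T -> \bar R}).
Variable g : T -> R.
Hypothesis mg : measurable_fun setT g.

(** The integral of the distribution function [nu {g > u}] over [u > t]: the part of the
    rearrangement of [g] above height [t]. *)
Definition excess (t : R) : \bar R := \int[nu]_x (Num.max (g x - t) 0)%:E.

Lemma measurable_gt_level (t : R) : measurable [set x | (t < g x)%R].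
Proof.
rewrite (_ : [set x | _] = setT `&` g @^-1` `]t, +oo[%classic).
  by apply: mg => //; exact: measurable_itv.
by rewrite setTI; apply/seteqP; split => x /=; rewrite in_itv/= andbT.
Qed.

Lemma measurable_excess (t : R) : measurable_fun setT (fun x => (Num.max (g x - t) 0)%:E).
Proof.
apply/measurable_EFinP; apply: measurable_maxr => //.
exact: measurable_funB.
Qed.

Let mexcess := measurable_excess.

Let mlevel (t c : R) :
  measurable_fun setT (fun x => c%:E * (\1_[set x | (t < g x)%R] x)%:E).
Proof.
apply: measurable_funeM; apply/measurable_EFinP.
exact: measurable_indic (measurable_gt_level t).
Qed.

Lemma integral_excess_level (u t c : R) : (0 <= c)%R ->
  \int[nu]_x ((Num.max (g x - t) 0)%:E + c%:E * (\1_[set x | (u < g x)%R] x)%:E) =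
  excess t + c%:E * nu [set x | (u < g x)%R].
Proof.
move=> c0; have mA := measurable_gt_level u.
rewrite ge0_integralD//.
- rewrite ge0_integralZl_EFin ?integral_indic ?setIT//.
  by apply/measurable_EFinP; exact: measurable_indic.
- by move=> x _; rewrite lee_fin le_max lexx orbT.
- by move=> x _; rewrite mule_ge0 ?lee_fin.
Qed.

Lemma excess_ge0 t : 0 <= excess t.
Proof. by apply: integral_ge0 => x _; rewrite lee_fin le_max lexx orbT. Qed.

(** The layer between the levels [t'] and [t] has height at most [t - t'] and lives on the set where
    [g] exceeds [t']. *)
Lemma excess_le (t' t : R) : (t' <= t)%R ->
  excess t' <= excess t + (t - t')%:E * nu [set x | (t' < g x)%R].
Proof.
move=> tt; rewrite -integral_excess_level ?subr_ge0//.
apply: ge0_le_integral => //.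
- by move=> x _; rewrite lee_fin le_max lexx orbT.
- exact: emeasurable_funD.
move=> x _; rewrite -EFinM -EFinD lee_fin indicE.
have [lt|le] := ltP t' (g x).
  rewrite mem_set// mulr1 ge_max; apply/andP; split.
    by rewrite -lerBlDr le_max; apply/orP; left; lra.
  by rewrite addr_ge0 ?subr_ge0// le_max lexx orbT.
rewrite memNset; last by apply/negP; rewrite -leNgt.
by rewrite mulr0 addr0 max_r ?subr_le0// le_max lexx orbT.
Qed.

(** The intermediate level [u] is there to tend to [t] from below: lower bounds on [nu {g > u}] hold
    only strictly below the level. *)
Lemma excess_ge (t' u t : R) : (t' <= u <= t)%R ->
  excess t + (u - t')%:E * nu [set x | (u < g x)%R] <= excess t'.
Proof.
move=> /andP[tu ut]; rewrite -integral_excess_level ?subr_ge0//.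
apply: ge0_le_integral => //.
- by move=> x _; rewrite adde_ge0 ?mule_ge0 ?lee_fin ?subr_ge0// le_max lexx orbT.
- exact: emeasurable_funD.
move=> x _; rewrite -EFinM -EFinD lee_fin indicE.
have [lt|le] := ltP u (g x).
  rewrite mem_set// mulr1 le_max; apply/orP; left.
  by rewrite -lerBrDr ge_max; apply/andP; split; lra.
rewrite memNset; last by apply/negP; rewrite -leNgt.
rewrite mulr0 addr0 (@max_r _ _ (g x - t)%R); first by rewrite le_max lexx orbT.
by rewrite subr_le0 (le_trans le).
Qed.

(** The bathtub bound, from [g x <= t + Num.max (g x - t) 0] on [A]. *)
Lemma integral_le_excess (A : set T) (t : R) : measurable A -> (0 <= t)%R ->
  (forall x, 0 <= g x)%R ->
  \int[nu]_(x in A) (g x)%:E <= t%:E * nu A + excess t.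
Proof.
move=> mA t0 g0.
have -> : t%:E * nu A + excess t = \int[nu]_x (t%:E * (\1_A x)%:E + (Num.max (g x - t) 0)%:E).
  rewrite ge0_integralD//.
  - rewrite ge0_integralZl_EFin ?integral_indic ?setIT//.
    by apply/measurable_EFinP; exact: measurable_indic.
  - by move=> x _; rewrite mule_ge0 ?lee_fin.
  - by apply: measurable_funeM; apply/measurable_EFinP; exact: measurable_indic.
  - by move=> x _; rewrite lee_fin le_max lexx orbT.
rewrite integral_mkcond; apply: ge0_le_integral => //.
- by move=> x _; rewrite erestrict_ge0// => y _; rewrite lee_fin.
- apply/(measurable_restrictT _ _).1 => //; apply/measurable_EFinP.
  exact: measurable_funTS.
- apply: emeasurable_funD => //; apply: measurable_funeM.
  by apply/measurable_EFinP; exact: measurable_indic.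
move=> x _; rewrite patchE indicE; case: ifPn => xA.
  rewrite mule1 -EFinD lee_fin -lerBlDl le_max lexx//.
by rewrite mule0 add0e lee_fin le_max lexx orbT.
Qed.

End excess.

(** * The decreasing rearrangement *)

Section level.
Local Open Scope ereal_scope.
Context d (T : measurableType d) (R : realType) (nu : {measure set T -> \bar R}).
Variables (f : T -> R) (p : R).
Hypotheses (mf : measurable_fun setT f) (f0 : forall x, (0 <= f x)%R).
Hypotheses (p1 : (1 < p)%R) (fp : \int[nu]_x (f x `^ p)%:E < +oo).

Let p0 : (0 < p)%R. Proof. exact: lt_trans p1. Qed.

(* The decreasing rearrangement of [f]. *)
Definition level (s : R) : R :=
  inf [set t | (0 <= t)%R /\ nu [set x | (t < f x)%R] <= s%:E].

Let mfp : measurable_fun setT (fun x => f x `^ p)%R.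
Proof.
by apply: (@measurableT_comp _ _ _ _ _ _ (fun y : R => y `^ p)%R).
Qed.

(** Chebyshev's inequality, which makes the set defining [level s] nonempty. *)
Let tail_le (t : R) : (0 < t)%R ->
  (t `^ p)%:E * nu [set x | (t < f x)%R] <= \int[nu]_x (f x `^ p)%:E.
Proof.
move=> t0; have mA := measurable_gt_level mf t.
have <- : \int[nu]_x (\1_[set x | (t < f x)%R] x)%:E = nu [set x | (t < f x)%R].
  by rewrite integral_indic ?setIT.
rewrite -ge0_integralZl_EFin//; first last.
- exact: powR_ge0.
- by apply/measurable_EFinP; exact: measurable_indic.
apply: ge0_le_integral => //.
- by move=> x _; rewrite mule_ge0 ?lee_fin ?powR_ge0.
- by apply: measurable_funeM; apply/measurable_EFinP; exact: measurable_indic.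
- exact/measurable_EFinP.
move=> x _; rewrite -EFinM lee_fin indicE; have [lt|le] := ltP t (f x).
  rewrite mem_set// mulr1 ge0_ler_powR ?nnegrE ?(ltW lt)//; exact: ltW.
rewrite memNset; last by apply/negP; rewrite -leNgt.
by rewrite mulr0 powR_ge0.
Qed.

Let level_nonempty (s : R) : (0 < s)%R ->
  [set t | (0 <= t)%R /\ nu [set x | (t < f x)%R] <= s%:E] !=set0.
Proof.
move=> s0; set E := \int[nu]_x (f x `^ p)%:E.
have E0 : 0 <= E by apply: integral_ge0 => x _; rewrite lee_fin powR_ge0.
have Efin : E \is a fin_num by rewrite ge0_fin_numE.
pose c := ((fine E + 1) / s)%R.
have c0 : (0 < c)%R by rewrite divr_gt0// ltr_wpDl ?fine_ge0.
exists (c `^ p^-1)%R; split; first exact: powR_ge0.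
have := tail_le (powR_gt0 p^-1 c0).
rewrite -powRrM mulVf ?gt_eqF// powRr1 ?(ltW c0)// => H.
rewrite -(@lee_pmul2l _ c%:E)// ?lte_fin//.
apply: le_trans H _; rewrite -/E -(fineK Efin) -EFinM lee_fin /c.
by rewrite divfK ?gt_eqF// lerDl.
Qed.

Let level_lbound (s : R) :
  has_lbound [set t | (0 <= t)%R /\ nu [set x | (t < f x)%R] <= s%:E].
Proof. by exists 0%R => t []. Qed.

Lemma level_ge0 s : (0 < s)%R -> (0 <= level s)%R.
Proof. by move=> s0; apply: lb_le_inf => [|t []//]; exact: level_nonempty. Qed.

Lemma level_nonincreasing s s' : (0 < s)%R -> (s <= s')%R -> (level s' <= level s)%R.
Proof.
move=> s0 ss; apply: lb_le_inf; first exact: level_nonempty.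
move=> t [t0 ts]; apply: ge_inf; first exact: level_lbound.
by split => //; apply: le_trans ts _; rewrite lee_fin.
Qed.

Lemma lt_level s t : (0 <= t)%R -> (t < level s)%R -> s%:E < nu [set x | (t < f x)%R].
Proof.
move=> t0 ts; rewrite ltNge; apply/negP => H.
by move: ts; rewrite ltNge => /negP; apply; apply: ge_inf.
Qed.

(** The infimum defining [level] is attained, by continuity of [nu] from below along the heights
    [level s + harmonic n]. *)
Lemma tail_level s : (0 < s)%R -> nu [set x | (level s < f x)%R] <= s%:E.
Proof.
move=> s0; pose A n := [set x | (level s + harmonic n < f x)%R].
have AE : [set x | (level s < f x)%R] = \bigcup_n A n.
  apply/seteqP; split => x /=.
    rewrite -subr_gt0 => h0.
    have [n _ /(_ n (leqnn n))/=] : \forall n \near \oo, (@harmonic R n < f x - level s)%R.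
      have /cvgrPdist_lt/(_ _ h0) := @cvg_harmonic R.
      by apply: filterS => n; rewrite sub0r normrN ger0_norm// harmonic_ge0.
    by rewrite ltrBrDl => H; exists n.
  move=> [n _]; rewrite /A/=; apply: le_lt_trans.
  by rewrite lerDl harmonic_ge0.
have mA n : measurable (A n) by exact: measurable_gt_level.
have cvA : nu \o A @ \oo --> nu (\bigcup_n A n).
  apply: nondecreasing_cvg_mu => //; first exact: bigcup_measurable.
  apply/nondecreasing_seqP => n; apply/subsetPset => x; rewrite /A/=.
  by apply: le_lt_trans; rewrite lerD2l /harmonic/= lef_pV2 ?posrE// ler_nat.
rewrite AE -(cvg_lim _ cvA)//.
apply: lime_le; first by apply/cvg_ex; exists (nu (\bigcup_n A n)).
apply: nearW => n /=.
have : (level s < level s + harmonic n)%R by rewrite ltrDl harmonic_gt0.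
move=> /(inf_lt (level_nonempty s0))[t [t0 ts] tl].
apply: le_trans ts; apply: le_measure; rewrite ?inE//; first exact: measurable_gt_level.
by move=> x; rewrite /A/=; apply: lt_trans.
Qed.

End level.

(** * Majorant and energy along the geometric mesh *)

Section mesh.
Local Open Scope ereal_scope.
Context d (T : measurableType d) (R : realType) (nu : {measure set T -> \bar R}).
Variables (f : T -> R) (p s0 rho : R).
Hypotheses (mf : measurable_fun setT f) (f0 : forall x, (0 <= f x)%R).
Hypotheses (p1 : (1 < p)%R) (fp : \int[nu]_x (f x `^ p)%:E < +oo).
Hypotheses (s0_gt0 : (0 < s0)%R) (rho1 : (1 < rho)%R).

Let p0 : (0 < p)%R. Proof. exact: lt_trans p1. Qed.
Let rho0 : (0 < rho)%R. Proof. exact: lt_trans rho1. Qed.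
Let g x := (f x `^ p)%R.
Let mg : measurable_fun setT g.
Proof. by apply: (@measurableT_comp _ _ _ _ _ _ (fun y : R => y `^ p)%R). Qed.

Definition node (i : nat) : R := s0 * rho ^+ i.
Local Notation s := node.
Local Notation t i := (level nu f (s i)).

Lemma node_gt0 i : (0 < s i)%R.
Proof. by rewrite mulr_gt0// exprn_gt0. Qed.

Lemma nodeS i : s i.+1 = (rho * s i)%R.
Proof. by rewrite /node exprS mulrCA. Qed.

Lemma node_lt i : (s i < s i.+1)%R.
Proof. by rewrite nodeS ltr_pMl// node_gt0. Qed.

Let t_ge0 i : (0 <= t i)%R. Proof. exact: (level_ge0 mf f0 p1 fp (node_gt0 i)). Qed.
Let t_le i : (t i.+1 <= t i)%R.
Proof. by apply: (level_nonincreasing mf f0 p1 fp); rewrite ?node_gt0// ltW// node_lt. Qed.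

Let pow_lt (u v : R) : (0 <= u)%R -> (0 <= v)%R -> (u `^ p < v `^ p)%R = (u < v)%R.
Proof.
move=> u0 v0; apply/idP/idP; last by apply: gt0_ltr_powR.
by apply: contraTT; rewrite -!leNgt => h; apply: ge0_ler_powR => //; exact: ltW.
Qed.

Let level_setE (u : R) : (0 <= u)%R ->
  [set x | (u `^ p < g x)%R] = [set x | (u < f x)%R].
Proof. by move=> u0; apply/seteqP; split => x /=; rewrite pow_lt. Qed.

Lemma excess_level_lty : excess nu f (t 0%N) < +oo.
Proof.
have mA := measurable_gt_level mf (t 0%N).
have mi : measurable_fun setT (fun x => (\1_[set x | (t 0%N < f x)%R] x)%:E : \bar R).
  by apply/measurable_EFinP; exact: measurable_indic.
have mp : measurable_fun setT (fun x => (f x `^ p)%:E) by exact/measurable_EFinP.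
have H : excess nu f (t 0%N) <=
    \int[nu]_x ((\1_[set x | (t 0%N < f x)%R] x)%:E + (f x `^ p)%:E).
  apply: ge0_le_integral => //.
  - by move=> x _; rewrite lee_fin le_max lexx orbT.
  - exact: measurable_excess.
  - exact: emeasurable_funD.
  move=> x _; rewrite -EFinD lee_fin indicE.
  have [lt|le] := ltP (t 0%N) (f x).
    rewrite mem_set// ge_max addr_ge0 ?powR_ge0// andbT.
    apply: (@le_trans _ _ (f x)); first by rewrite lerBlDr lerDl.
    have [f1|f1] := leP (f x) 1%R; first by rewrite -[leLHS]addr0 lerD ?powR_ge0.
    by rewrite -[leLHS]add0r lerD// le1r_powR// ltW.
  by rewrite max_r ?subr_le0// addr_ge0 ?powR_ge0.
apply: le_lt_trans H _; rewrite ge0_integralD//; last first.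
  by move=> x _; rewrite lee_fin powR_ge0.
rewrite integral_indic// setIT lte_add_pinfty//.
by apply: le_lt_trans (tail_level mf f0 p1 fp (node_gt0 0)) _; rewrite ltry.
Qed.

(* [y 0] is the integral over [(0, s 0)] of the decreasing rearrangement, to which
   the later [y i] add upper Riemann sums. *)
Fixpoint majorant (i : nat) : R :=
  if i is j.+1 then majorant j + t j * (s j.+1 - s j)
  else t 0%N * s 0%N + fine (excess nu f (t 0%N)).
Local Notation y := majorant.

Let excess_fin : excess nu f (t 0%N) \is a fin_num.
Proof. by rewrite ge0_fin_numE ?excess_ge0// excess_level_lty. Qed.

(** The left-hand side is the integral of the rearrangement over [(0, s i)]. Lowering the level to
    [t i.+1] adds at most [(t i - t i.+1) * s i.+1] to the excess. *)
Lemma excess_majorant i : (t i * s i)%:E + excess nu f (t i) <= (y i)%:E.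
Proof.
elim: i => [|i IH]; first by rewrite /= EFinD fineK.
rewrite /majorant -/majorant EFinD; apply: le_trans (leeD2r _ IH).
have := excess_le nu mf (t_le i).
have := tail_level mf f0 p1 fp (node_gt0 i.+1).
set A := nu _ => A1 H.
apply: (@le_trans _ _ ((t i.+1 * s i.+1)%:E +
    (excess nu f (t i) + (t i - t i.+1)%:E * (s i.+1)%:E))).
  rewrite leeD2l//; apply: le_trans H _; rewrite leeD2l//.
  by apply: lee_wpmul2l => //; rewrite lee_fin subr_ge0 t_le.
rewrite addeA [leLHS]addeAC -EFinM -EFinD addeAC -EFinD leeD2r// lee_fin; lra.
Qed.

Lemma integral_le_majorant i (A : set T) : measurable A -> nu A <= (s i)%:E ->
  \int[nu]_(x in A) (f x)%:E <= (y i)%:E.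
Proof.
move=> mA As; apply: le_trans (excess_majorant i).
apply: le_trans (integral_le_excess nu mf mA (t_ge0 i) f0) _.
by rewrite leeD2r// EFinM lee_wpmul2l// lee_fin t_ge0.
Qed.

Let ts_le i : (t i * s i <= y i)%R.
Proof.
rewrite -lee_fin; apply: le_trans (excess_majorant i).
by rewrite leeDl// excess_ge0.
Qed.

Lemma majorant_ge0 i : (0 <= y i)%R.
Proof. by apply: le_trans (ts_le i); rewrite mulr_ge0 ?t_ge0 ?(ltW (node_gt0 i)). Qed.

Lemma majorant_le i : (y i <= y i.+1)%R.
Proof. by rewrite /= lerDl mulr_ge0 ?t_ge0 ?subr_ge0 ?(ltW (node_lt i)). Qed.

(** The increment is [(rho - 1) * (t i * s i)], and [t i * s i <= y i]. *)
Lemma majorant_growth i : (y i.+1 <= rho * y i)%R.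
Proof.
rewrite /= nodeS -[X in (_ * (_ - X))%R]mul1r -mulrBl mulrCA.
have -> : (rho * y i = y i + (rho - 1) * y i)%R by ring.
by rewrite lerD2l ler_wpM2l// subr_ge0 ltW.
Qed.

Definition energy (i : nat) : R := y i `^ p * s i `^ (1 - p).
Local Notation tau := energy.

Lemma energy_ge0 i : (0 <= tau i)%R.
Proof. by rewrite mulr_ge0 ?powR_ge0. Qed.

Lemma energyE i : tau i = ((y i / s i) `^ p * s i)%R.
Proof.
have s1 := node_gt0 i.
rewrite /energy powRM ?invr_ge0 ?(ltW s1)// ?majorant_ge0// -powR_inv1 ?(ltW s1)//.
rewrite -powRrM mulN1r -mulrA -{3}(powRr1 (ltW s1)) -powRD ?(gt_eqF s1) ?implybT//.
by rewrite addrC.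
Qed.

(** In the form [energyE] the mean [y i / s i] decreases, and only the factor [s i] grows. *)
Lemma energy_growth i : (tau i.+1 <= rho * tau i)%R.
Proof.
have si := ltW (node_gt0 i); have si1 := ltW (node_gt0 i.+1).
rewrite !energyE [leRHS](_ : _ = (y i / s i) `^ p * s i.+1)%R; last first.
  by rewrite nodeS; ring.
apply: ler_wpM2r => //.
apply: ge0_ler_powR; rewrite ?(ltW p0)// ?nnegrE ?divr_ge0 ?majorant_ge0//.
rewrite nodeS invfM mulrA; apply: ler_wpM2r; first by rewrite invr_ge0.
by rewrite ler_pdivrMr// mulrC majorant_growth.
Qed.

Let T_ i : R := t i `^ p.

Let T_le i : (T_ i.+1 <= T_ i)%R.
Proof. by apply: ge0_ler_powR; rewrite ?nnegrE ?t_ge0 ?(ltW p0). Qed.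

(* Jensen's inequality, through the tangent at the mean [y 0 / s 0]. *)
Let jensen : (tau 0%N)%:E <= (T_ 0%N * s 0%N)%:E + excess nu g (T_ 0%N).
Proof.
have s1 := node_gt0 0.
set u := (y 0%N / s 0%N)%R.
have u0 : (0 <= u)%R by rewrite divr_ge0 ?majorant_ge0 ?ltW.
(* The gap at [t 0] between the [p]-th power and its tangent at [u]. Adding it on [{f > t 0}] turns
   the bound for excesses into the tangent inequality at [f x]. *)
pose c := ((p - 1) * u `^ p - p * u `^ (p - 1) * t 0%N + T_ 0%N)%R.
have c0 : (0 <= c)%R.
  by have := powR_tangent p1 (t_ge0 0) u0; rewrite /c /T_; lra.
have k0 : (0 <= p * u `^ (p - 1))%R by rewrite mulr_ge0 ?powR_ge0 ?ltW.
have H : (p * u `^ (p - 1))%:E * excess nu f (t 0%N) <=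
    excess nu g (T_ 0%N) + c%:E * nu [set x | (t 0%N < f x)%R].
  rewrite -(level_setE (t_ge0 0)) -integral_excess_level// -ge0_integralZl_EFin//; first last.
  - exact: measurable_excess.
  - by move=> x _; rewrite lee_fin le_max lexx orbT.
  apply: ge0_le_integral => //.
  - by move=> x _; rewrite mule_ge0 ?lee_fin// le_max lexx orbT.
  - by apply: measurable_funeM; exact: measurable_excess.
  - apply: emeasurable_funD; first exact: measurable_excess.
    apply: measurable_funeM; apply/measurable_EFinP.
    exact: measurable_indic (measurable_gt_level mg _).
  move=> x _; rewrite -!EFinM -EFinD lee_fin indicE.
  have [lt|le] := ltP (T_ 0%N) (g x).
    rewrite mem_set// mulr1; have ltf : (t 0%N < f x)%R by rewrite -pow_lt.
    rewrite !max_l ?subr_ge0 ?(ltW lt) ?(ltW ltf)//.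
    by have := powR_tangent p1 (f0 x) u0; rewrite /c /T_ /g; lra.
  rewrite (@max_r _ _ (f x - _)%R); last first.
    by rewrite subr_le0 leNgt -pow_lt// -leNgt.
  by rewrite mulr0 addr_ge0 ?mulr_ge0// le_max lexx orbT.
have {}H : (p * u `^ (p - 1))%:E * excess nu f (t 0%N) <=
    excess nu g (T_ 0%N) + (c * s 0%N)%:E.
  apply: le_trans H _; rewrite leeD2l// EFinM lee_wpmul2l// ?lee_fin//.
  exact: (tail_level mf f0 p1 fp (node_gt0 0)).
have us : (u * s 0%N = y 0%N)%R by rewrite /u divfK// gt_eqF.
have ue : (u `^ p = u * u `^ (p - 1))%R by rewrite mulr_powRB1.
rewrite energyE -/u.
have -> : (u `^ p * s 0%N = p * u `^ (p - 1) * fine (excess nu f (t 0%N)) - c * s 0%N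
    + T_ 0%N * s 0%N)%R.
  have -> : fine (excess nu f (t 0%N)) = (u * s 0%N - t 0%N * s 0%N)%R.
    by rewrite us /= addrAC subrr add0r.
  by rewrite /c ue; ring.
rewrite EFinD EFinB EFinM fineK// addeC leeD2l//.
by rewrite leeBlDr.
Qed.

Let excess_step (T' T0 si : R) : (0 <= T' <= T0)%R -> (0 <= si)%R ->
  (forall u, (0 <= u < T0)%R -> si%:E <= nu [set x | (u < g x)%R]) ->
  ((T0 - T') * si)%:E + excess nu g T0 <= excess nu g T'.
Proof.
move=> /andP[T'0 TT] si0 H.
have [->|TN] := eqVneq T' T0; first by rewrite subrr mul0r add0e.
have {}TT : (T' < T0)%R by rewrite lt_neqAle TN.
apply/lee_addgt0Pr => e e0.
(* Stopping at [u] instead of [T0] loses [(T0 - u) * si <= e]; the added [1] covers [si = 0]. *)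
pose u := Num.max T' (T0 - e / (si + 1))%R.
have si1 : (0 < si + 1)%R by rewrite ltr_wpDl.
have uT : (0 <= u < T0)%R.
  rewrite le_max T'0/= gt_max TT/= ltrBlDr ltrDl divr_gt0//.
have Tu : (T' <= u <= T0)%R.
  by rewrite le_max lexx/= ltW//; case/andP: uT.
apply: le_trans (leeD2r e%:E (excess_ge nu mg Tu)).
rewrite [leLHS]addeC -[leRHS]addeA; apply: leeD2l.
apply: (@le_trans _ _ ((u - T')%:E * si%:E + e%:E)); last first.
  by rewrite leeD2r// lee_wpmul2l ?lee_fin ?subr_ge0 ?(andP Tu).1// H.
rewrite -EFinM -EFinD lee_fin.
have ue : (T0 - u <= e / (si + 1))%R.
  by rewrite lerBlDl -lerBlDr le_max lexx orbT.
have : ((T0 - u) * si <= e)%R.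
  apply: (@le_trans _ _ (e / (si + 1) * si)%R); first by rewrite ler_wpM2r.
  rewrite mulrAC -mulrA ler_piMr ?(ltW e0)// ler_pdivrMr// mul1r lerDl//.
lra.
Qed.

Let below_T i (u : R) : (0 <= u < T_ i)%R -> (s i)%:E <= nu [set x | (u < g x)%R].
Proof.
move=> /andP[u0 uT].
have uE : u = ((u `^ p^-1) `^ p)%R by rewrite -powRrM mulVf ?gt_eqF// powRr1.
rewrite uE level_setE ?powR_ge0//; apply: ltW; apply: lt_level; first exact: powR_ge0.
by rewrite -pow_lt ?powR_ge0// -uE.
Qed.

(** [jensen] bounds the energy on [(0, s 0)], and the sum is a lower Riemann sum of the [p]-th power
    of the rearrangement. Lowering the level to [0] at the end recovers the whole integral. *)
Lemma energy_rearrangement n :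
  (tau 0%N + \sum_(i < n) t i.+1 `^ p * (s i.+1 - s i))%:E <= \int[nu]_x (f x `^ p)%:E.
Proof.
have K k : (tau 0%N + \sum_(i < k) T_ i.+1 * (s i.+1 - s i))%:E <=
    (T_ k * s k)%:E + excess nu g (T_ k).
  elim: k => [|k IH]; first by rewrite big_ord0 addr0; exact: jensen.
  rewrite big_ord_recr/= addrA EFinD.
  apply: le_trans (leeD2r _ IH) _.
  have Tk : (0 <= T_ k.+1 <= T_ k)%R by rewrite powR_ge0 T_le.
  have := excess_step Tk (ltW (node_gt0 k)) (@below_T k).
  move=> /(leeD2l (T_ k.+1 * s k.+1)%:E); apply: le_trans.
  rewrite [leRHS]addeA [leLHS]addeAC; apply: leeD2r; rewrite -!EFinD lee_fin.
  move: (T_ k.+1) (T_ k) (s k.+1) (s k) => a b c e.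
  by rewrite le_eqVlt; apply/orP; left; apply/eqP; ring.
apply: le_trans (K n) _.
have Tn : (0 <= (0 : R) <= T_ n)%R by apply/andP; split => //; exact: powR_ge0.
have := excess_step Tn (ltW (node_gt0 n)) (@below_T n).
rewrite subr0 => /le_trans; apply.
rewrite /excess le_eqVlt; apply/orP; left; apply/eqP; apply: eq_integral => x _.
by rewrite subr0 max_l// powR_ge0.
Qed.

(** The costs form an upper Riemann sum. Shifting the index by one compares it with the lower sum of
    [energy_rearrangement], at the price of the ratio [rho] of consecutive cells; the first cell is
    at most [(rho - 1) * tau 0]. *)
Lemma energy_cost n :
  (tau 0%N + \sum_(i < n) (y i.+1 - y i) `^ p * (s i.+1 - s i) `^ (1 - p)
     <= rho * fine (\int[nu]_x (f x `^ p)%:E))%R.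
Proof.
have rho1' : (0 < rho - 1)%R by rewrite subr_gt0.
have costE i : ((y i.+1 - y i) `^ p * (s i.+1 - s i) `^ (1 - p) =
    T_ i * (s i.+1 - s i))%R.
  have d0 : (0 < s i.+1 - s i)%R by rewrite subr_gt0 node_lt.
  rewrite /= [(y i + _)%R]addrC addrK powRM ?t_ge0 ?(ltW d0)// -mulrA -powRD.
    have -> : (p + (1 - p) = 1)%R by ring.
    by rewrite powRr1 ?(ltW d0).
  by rewrite (gt_eqF d0) implybT.
under eq_bigr do rewrite costE.
have Ep : \int[nu]_x (f x `^ p)%:E \is a fin_num.
  by rewrite ge0_fin_numE// integral_ge0// => x _; rewrite lee_fin powR_ge0.
have en k : (tau 0%N + \sum_(i < k) T_ i.+1 * (s i.+1 - s i)
    <= fine (\int[nu]_x (f x `^ p)%:E))%R.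
  by rewrite -lee_fin fineK//; exact: energy_rearrangement.
set e := fine _ in en *.
have en0 : (tau 0%N <= e)%R by apply: le_trans (en 0%N); rewrite lerDl big_ord0.
case: n => [|n].
  rewrite big_ord0 [leLHS]addr0; apply: (le_trans en0); apply: ler_peMl; last exact: ltW.
  exact: le_trans (energy_ge0 0) en0.
apply: le_trans (ler_wpM2l (ltW rho0) (en n)).
rewrite big_ord_recl/= [leRHS]mulrDr [X in (_ <= _ + X)%R]mulr_sumr [leLHS]addrA.
apply: lerD; last first.
  apply: ler_sum => i _; rewrite /bump/= add1n (nodeS i.+1) {2}(nodeS i).
  move: (T_ i.+1) (s i.+1) (s i) => u v w.
  by rewrite le_eqVlt; apply/orP; left; apply/eqP; ring.
have Ts : (T_ 0%N * s 0%N <= tau 0%N)%R.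
  have s1 := node_gt0 0; rewrite energyE; apply: ler_wpM2r; first exact: ltW.
  apply: ge0_ler_powR; rewrite ?nnegrE ?(ltW p0)// ?divr_ge0 ?majorant_ge0 ?(ltW s1)//.
  by rewrite ler_pdivlMr.
have {}Ts := ler_wpM2l (ltW rho1') Ts.
rewrite nodeS; move: Ts; move: (T_ 0%N) (s 0%N) (tau 0%N) => u v w; lra.
Qed.

End mesh.

(** * The sharp constant in terms of the profile *)

Lemma hardy_k_powR {R : realType} (p : R) : 1 < p ->
  hardy_k p p `^ p = p / profile_max p.
Proof.
move=> p1; have p0 : 0 < p by apply: lt_trans p1.
have p10 : 0 < p - 1 by rewrite subr_gt0.
have c0 : 0 < conj_exponent p by rewrite divr_gt0.
rewrite /hardy_k eqxx powRM ?powR_ge0// -!powRrM mulVf ?gt_eqF// powRr1 ?(ltW p0)//.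
have -> : (conj_exponent p)^-1 * p = p - 1.
  by rewrite /conj_exponent; field; rewrite !gt_eqF.
congr (_ * _); rewrite /profile_max -powRN -[(p - 1) / p]invf_div -powR_inv1 ?(ltW c0)//.
by rewrite -powRrM mulrNN mul1r.
Qed.

Lemma hardy_k_powR_lt {R : realType} (p q : R) (r := q / p - 1) : 1 < p -> p < q ->
  hardy_k q p `^ q = (r / ((r + 1) * profile_area p r 1)) `^ r.
Proof.
move=> p1 pq; have p0 : 0 < p by apply: lt_trans p1.
have q0 : 0 < q by apply: lt_trans pq.
have r0 : 0 < r by rewrite subr_gt0 ltr_pdivlMr// mul1r.
rewrite /hardy_k lt_eqF// -/r -powRrM.
have -> : (p^-1 - q^-1) * q = r by rewrite /r; field; rewrite !gt_eqF.
rewrite -(Beta_profile_area p1 r0).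
by have -> : p * (r + 1) = q by rewrite /r; field; rewrite gt_eqF.
Qed.

Lemma hardy_k_gt0 {R : realType} (p q : R) : 1 < p -> p <= q -> 0 < hardy_k q p.
Proof.
move=> p1; have p0 : 0 < p by apply: lt_trans p1.
have k0 : 0 <= hardy_k q p by rewrite /hardy_k; case: ifP; rewrite ?mulr_ge0 ?powR_ge0.
rewrite le_eqVlt => /predU1P[pq|pq].
  apply: (gt0_powR p0) => //; rewrite -{1}pq hardy_k_powR//.
  by rewrite divr_gt0 ?profile_max_gt0.
apply: (@gt0_powR _ _ q) => //; first exact: lt_trans pq.
have r0 : 0 < q / p - 1 by rewrite subr_gt0 ltr_pdivlMr// mul1r.
rewrite hardy_k_powR_lt//; apply: powR_gt0; apply: divr_gt0 => //.
by apply: mulr_gt0; [exact: addr_gt0|exact: profile_area_gt0].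
Qed.

(** * From the discrete inequalities to sums over the mesh *)

Section mesh_sum.
Local Open Scope ereal_scope.
Context d (T : measurableType d) (R : realType) (nu : {measure set T -> \bar R}).
Variables (f : T -> R) (p q s0 rho : R).
Hypotheses (mf : measurable_fun setT f) (f0 : forall x, (0 <= f x)%R).
Hypotheses (p1 : (1 < p)%R) (pq : (p <= q)%R) (fp : \int[nu]_x (f x `^ p)%:E < +oo).
Hypotheses (s0_gt0 : (0 < s0)%R) (rho1 : (1 < rho)%R).
Local Notation s := (node s0 rho).
Local Notation y := (majorant nu f s0 rho).
Local Notation tau := (energy nu f p s0 rho).

Let p0 : (0 < p)%R. Proof. exact: lt_trans p1. Qed.
Let q0 : (0 < q)%R. Proof. exact: lt_le_trans pq. Qed.
Let rho0 : (0 < rho)%R. Proof. exact: lt_trans rho1. Qed.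

Let y0 i : (0 <= y i)%R. Proof. exact: (majorant_ge0 mf f0 p1 fp s0_gt0 rho1). Qed.
Let s_gt0 i : (0 < s i)%R. Proof. exact: (node_gt0 s0_gt0 rho1). Qed.
Let y_le i : (y i <= y i.+1)%R. Proof. exact: (majorant_le mf f0 p1 fp s0_gt0 rho1). Qed.
Let tau0 i : (0 <= tau i)%R. Proof. exact: energy_ge0. Qed.

Let cost i := ((y i.+1 - y i) `^ p * (s i.+1 - s i) `^ (1 - p))%R.

Let cost_ge i th : (0 <= th)%R ->
  (th * (tau i.+1 - tau i)
    + (p - 1) * profile p th * tau i.+1 * ((rho - 1) / rho) <= cost i)%R.
Proof.
move=> th0; have p10 : (0 < p - 1)%R by rewrite subr_gt0.
have -> : th = ((th `^ (p - 1)^-1) `^ (p - 1))%R.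
  by rewrite -powRrM mulVf ?gt_eqF// powRr1.
rewrite profile_powR ?powR_ge0//.
have := @increment_cost R p (th `^ (p - 1)^-1)%R (s i) (s i.+1) (y i) (y i.+1) p1
  (powR_ge0 _ _) (s_gt0 i) (node_lt s0_gt0 rho1 i) (y0 i) (y_le i).
apply: le_trans; rewrite lerD2l.
suff -> : ((rho - 1) / rho = (s i.+1 - s i) / s i.+1)%R by [].
have := s_gt0 i; rewrite nodeS; move: (s i) => u u0.
by field; rewrite !gt_eqF.
Qed.

Let mesh_energy (n : nat) :
  (tau n `^ (q / p) + (rho `^ (q - q / p) - 1) * \sum_(i < n) tau i.+1 `^ (q / p)
   <= rho `^ q * hardy_k q p `^ q * (tau 0%N + \sum_(i < n) cost i) `^ (q / p))%R.
Proof.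
have growth := energy_growth mf f0 p1 fp s0_gt0 rho1.
have [pqE|pqN] := eqVneq p q.
  have E0 : (0 <= tau 0%N + \sum_(i < n) cost i)%R.
    by rewrite addr_ge0// sumr_ge0// => i _; rewrite mulr_ge0 ?powR_ge0.
  rewrite -pqE divff ?gt_eqF// hardy_k_powR// !powRr1//.
  under eq_bigr do rewrite powRr1//.
  exact: discrete_hardy.
have {pqN}pq' : (p < q)%R by rewrite lt_neqAle pqN.
have r0 : (0 < q / p - 1)%R by rewrite subr_gt0 ltr_pdivlMr// mul1r.
rewrite hardy_k_powR_lt//.
have qE : (q = p * ((q / p - 1) + 1))%R by field; rewrite gt_eqF.
have := @discrete_bliss R p q rho tau cost n p1 rho1 tau0 growth cost_ge _ r0 qE.
by rewrite subrK.
Qed.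

(** Since [y i]^ q * s i [^ (- a) = tau i]^ (q / p)[, and the shifted product is]rho [^ a] times the
    next such term, summation by parts turns the left-hand side into that of [mesh_energy]. *)
Lemma mesh_sum_le (n : nat) (a := (q - q / p)%R) :
  (y 0%N `^ q * s 0%N `^ (- a) + \sum_(i < n) (y i.+1 `^ q - y i `^ q) * s i `^ (- a)
   <= rho `^ q * hardy_k q p `^ q
      * (rho * fine (\int[nu]_x (f x `^ p)%:E)) `^ (q / p))%R.
Proof.
have tauE i : (y i `^ q * s i `^ (- a) = tau i `^ (q / p))%R.
  rewrite /energy powRM ?powR_ge0// -!powRrM; congr (_ `^ _ * _ `^ _)%R.
    by field; rewrite gt_eqF.
  by rewrite /a; field; rewrite gt_eqF.
have tauSE i : (y i.+1 `^ q * s i `^ (- a) = rho `^ a * tau i.+1 `^ (q / p))%R.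
  have rr : (rho `^ a * rho `^ (- a) = 1)%R.
    by rewrite powRN mulfV// gt_eqF// powR_gt0.
  rewrite -tauE (nodeS _ _ i) powRM ?(ltW rho0) ?(ltW (s_gt0 i))//.
  move: (s i `^ (- a))%R (rho `^ (- a))%R (y i.+1 `^ q)%R (rho `^ a)%R rr => u v w z zv.
  by transitivity (z * v * (w * u))%R; [rewrite zv mul1r|ring].
apply: (@le_trans _ _ (rho `^ q * hardy_k q p `^ q
    * (tau 0%N + \sum_(i < n) cost i) `^ (q / p))%R); last first.
  apply: ler_wpM2l; first by rewrite mulr_ge0 ?powR_ge0.
  have E0 : (0 <= tau 0%N + \sum_(i < n) cost i)%R.
    by rewrite addr_ge0// sumr_ge0// => i _; rewrite mulr_ge0 ?powR_ge0.
  have H := energy_cost mf f0 p1 fp s0_gt0 rho1 n.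
  apply: ge0_ler_powR => //; first by rewrite divr_ge0 ?ltW.
  by rewrite nnegrE; apply: le_trans H.
apply: le_trans (mesh_energy n).
under eq_bigr do rewrite mulrBl tauSE tauE.
rewrite tauE sumrB -mulr_sumr.
pose A i := (tau i `^ (q / p))%R.
have AS : (\sum_(i < n) A i.+1 - \sum_(i < n) A i = A n - A 0%N)%R.
  rewrite -sumrB -(big_mkord xpredT (fun i => A i.+1 - A i)%R).
  by rewrite telescope_sumr.
change (A 0%N + (rho `^ a * \sum_(i < n) A i.+1 - \sum_(i < n) A i)
  <= A n + (rho `^ a - 1) * \sum_(i < n) A i.+1)%R.
clearbody A; rewrite mulrBl mul1r; move: AS.
move: (\sum_(i < n) A i.+1)%R (\sum_(i < n) A i)%R => S S'; lra.
Qed.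

End mesh_sum.

(** * The inequality on the line *)

Section up_closed.
Local Open Scope ereal_scope.
Context {R : realType}.

Lemma measure_bigcup_le d (T : measurableType d) (m : {measure set T -> \bar R})
    (A : (set T)^nat) (c : \bar R) :
  (forall n, measurable (A n)) -> nondecreasing_seq A ->
  (forall n, m (A n) <= c) -> m (\bigcup_n A n) <= c.
Proof.
move=> mA ndA Ac; have cvA : m \o A @ \oo --> m (\bigcup_n A n).
  by apply: nondecreasing_cvg_mu => //; exact: bigcup_measurable.
rewrite -(cvg_lim _ cvA)//.
apply: lime_le; first by apply/cvg_ex; exists (m (\bigcup_n A n)).
exact: nearW.
Qed.

Definition up_closed (U : set R) := forall x y, U x -> (x <= y)%R -> U y.

Lemma measurable_up_closed (U : set (measurableTypeR R)) : up_closed U -> measurable U.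
Proof.
move=> upU; apply: is_interval_measurable => x y Ux Uy z /andP[xz _].
exact: upU xz.
Qed.

(* An up-closed set is an increasing union of half-lines [x_n, +oo[. *)
Lemma measure_up_closed_le (m : {measure set (measurableTypeR R) -> \bar R})
    (U : set R) (c : \bar R) : up_closed U -> 0 <= c ->
  (forall x, U x -> m `[x, +oo[%classic <= c) -> m U <= c.
Proof.
move=> upU c0 Uc.
have [->|/set0P[x0 Ux0]] := eqVneq U set0; first by rewrite measure0.
have bnd (u : R^nat) : nonincreasing_seq u -> (forall n, U (u n)) ->
    (forall x, U x -> exists n, (u n <= x)%R) -> m U <= c.
  move=> uni Uu ux; have -> : U = \bigcup_n `[u n, +oo[%classic.
    apply/seteqP; split => x /=.
      by move=> /ux[n unx]; exists n => //=; rewrite in_itv/= unx.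
    by move=> [n _]; rewrite /= in_itv/= andbT; apply: upU.
  apply: (measure_bigcup_le (m := m)) => //.
  - by move=> n k nk; apply/subsetPset => x; rewrite /= !in_itv/= !andbT; apply: le_trans; exact: uni.
  - by move=> n; exact: Uc.
(* Three shapes: the whole line, a closed half-line, an open half-line. *)
have [Ulb|Unlb] := pselect (has_lbound U); last first.
  apply: (bnd (fun n => x0 - n%:R)%R).
  - by move=> n k nk; rewrite lerD2l lerN2 ler_nat.
  - move=> n; apply: contrapT => Un; apply: Unlb; exists (x0 - n%:R)%R => x Ux.
    by rewrite leNgt; apply/negP => /ltW xn; apply: Un; exact: upU xn.
  - move=> x Ux; exists (Num.bound `|x0 - x|%R).
    by rewrite lerBlDr -lerBlDl (le_trans (ler_norm _))// ltW// archi_boundP ?normr_ge0.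
have [Ui|Ui] := pselect (U (inf U)).
  apply: (bnd (fun=> inf U)) => // x Ux; exists 0%N; exact: ge_inf.
apply: (bnd (fun n => inf U + harmonic n)%R).
- by move=> n k nk; rewrite lerD2l /harmonic/= lef_pV2 ?posrE// ler_nat ltnS.
- move=> n; have : (inf U < inf U + harmonic n)%R by rewrite ltrDl harmonic_gt0.
  by move=> /inf_lt[|x Ux /ltW]; [exists x0|exact: upU].
- move=> x Ux.
  have xi : (0 < x - inf U)%R.
    rewrite subr_gt0 lt_neqAle ge_inf// andbT; apply/eqP => e.
    by apply: Ui; rewrite e.
  have [n _ /(_ n (leqnn n))/=] : \forall n \near \oo, (@harmonic R n < x - inf U)%R.
    have /cvgrPdist_lt/(_ _ xi) := @cvg_harmonic R.
    by apply: filterS => n; rewrite sub0r normrN ger0_norm// harmonic_ge0.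
  by rewrite ltrBrDl => /ltW h; exists n.
Qed.

Lemma nondecreasing_emeasurable (F : R -> \bar R) :
  {homo F : x y / (x <= y)%R >-> x <= y} ->
  measurable_fun [set: measurableTypeR R] F.
Proof.
move=> ndF; apply: (measurability _ (ErealGenOInfty.measurableE R)) => //.
move=> _ [_ [r ->] <-]; rewrite setTI; apply: measurable_up_closed => x y /=.
rewrite !in_itv/= !andbT => rx xy; apply: lt_le_trans rx _; exact: ndF.
Qed.

End up_closed.

(** * The upper bound on a window of values of [N] *)

Section hardy_upper.
Local Open Scope ereal_scope.
Context {R : realType}.
Variables (mu nu : {measure set (measurableTypeR R) -> \bar R}).
Variables (f : measurableTypeR R -> R) (p q b : R).
Hypotheses (mf : measurable_fun setT f) (f0 : forall x, (0 <= f x)%R).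
Hypotheses (p1 : (1 < p)%R) (pq : (p <= q)%R) (b0 : (0 <= b)%R).
Hypothesis muckenhoupt : forall x : R,
  nu `]-oo, x]%classic `^ (conj_exponent p)^-1 * mu `[x, +oo[%classic `^ q^-1 <= b%:E.

Let p0 : (0 < p)%R. Proof. exact: lt_trans p1. Qed.
Let q0 : (0 < q)%R. Proof. exact: lt_le_trans pq. Qed.
Let p10 : (0 < p - 1)%R. Proof. by rewrite subr_gt0. Qed.
Let c0 : (0 < (conj_exponent p)^-1)%R. Proof. by rewrite invr_gt0 divr_gt0. Qed.
Let q10 : (0 < q^-1)%R. Proof. by rewrite invr_gt0. Qed.

Local Notation N x := (nu `]-oo, x]%classic).
Local Notation F x := (\int[nu]_(y in `]-oo, x]) (f y)%:E).

Lemma distribution_homo (x y : R) : (x <= y)%R -> N x <= N y.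
Proof.
move=> xy; apply: le_measure; rewrite ?inE//.
by apply: subset_itvl; rewrite bnd_simp.
Qed.

Lemma primitive_homo (x y : R) : (x <= y)%R -> F x <= F y.
Proof.
move=> xy; apply: ge0_subset_integral => //.
- by apply/measurable_EFinP; exact: measurable_funTS.
- by move=> z _; rewrite lee_fin.
- by apply: subset_itvl; rewrite bnd_simp.
Qed.

Let up_closed_ge (s : \bar R) : up_closed [set x | s <= N x].
Proof. by move=> x y /= sx xy; apply: le_trans sx (distribution_homo xy). Qed.

(* [q - q / p = q / p^*] *)
Lemma measure_distribution_ge (s : R) : (0 < s)%R ->
  mu [set x | s%:E <= N x] <= (b `^ q * s `^ (- (q - q / p)))%:E.
Proof.
move=> s0; apply: measure_up_closed_le => //.
  by rewrite lee_fin mulr_ge0 ?powR_ge0.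
move=> x /= sN; set m := mu _.
have m0 : 0 <= m by exact: measure_ge0.
have sp : (0 < s `^ (conj_exponent p)^-1)%R by exact: powR_gt0.
have H : (s `^ (conj_exponent p)^-1)%:E * m `^ q^-1 <= b%:E.
  apply: le_trans (muckenhoupt x); apply: lee_wpmul2r; first exact: poweR_ge0.
  rewrite -poweR_EFin; apply: gt0_ler_poweR => //; first exact: ltW.
  - by rewrite in_itv/= lee_fin (ltW s0) leey.
  - by rewrite in_itv/= measure_ge0 leey.
have {}H : m `^ q^-1 <= (b / s `^ (conj_exponent p)^-1)%:E.
  by rewrite EFinM lee_pdivlMr// muleC.
have := @gt0_ler_poweR R q (ltW q0) _ _ _ _ H.
rewrite -poweRrM mulVf ?gt_eqF// poweRe1// => /(_ _ _)/le_trans; apply.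
- by rewrite in_itv/= poweR_ge0 leey.
- by rewrite in_itv/= lee_fin leey andbT divr_ge0// ltW.
rewrite poweR_EFin lee_fin powRM ?invr_ge0 ?powR_ge0//.
rewrite ler_wpM2l ?powR_ge0// -powRN -powRrM.
rewrite le_eqVlt; apply/orP; left; apply/eqP; congr (_ `^ _)%R.
by rewrite /conj_exponent; field; rewrite !gt_eqF.
Qed.

(** Where [N x = +oo], a positive [mu [x, +oo[] would make the product in [muckenhoupt] infinite. *)
Lemma measure_distribution_pinfty : mu [set x | N x = +oo] = 0.
Proof.
apply/eqP; rewrite eq_le measure_ge0 andbT.
have -> : [set x | N x = +oo] = [set x | +oo <= N x].
  by apply/seteqP; split => x /=; [move=> ->|rewrite leye_eq => /eqP].
apply: measure_up_closed_le => // x /=; rewrite leye_eq => /eqP Nx.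
have := muckenhoupt x; rewrite Nx poweRyr ?gt_eqF//.
have [->//|m0] := eqVneq (mu `[x, +oo[%classic) 0.
by rewrite gt0_mulye ?poweR_gt0// ?lt0e ?m0 ?measure_ge0.
Qed.

Hypothesis fp : \int[nu]_x (f x `^ p)%:E < +oo.

Section window.
Variables (rho s0 : R) (n : nat).
Hypotheses (rho1 : (1 < rho)%R) (s0_gt0 : (0 < s0)%R).
Local Notation s := (node s0 rho).
Local Notation y := (majorant nu f s0 rho).
Local Notation U i := [set x | (s i)%:E <= N x].

Let y0 i : (0 <= y i)%R. Proof. exact: (majorant_ge0 mf f0 p1 fp s0_gt0 rho1). Qed.
Let y_le i : (y i <= y i.+1)%R. Proof. exact: (majorant_le mf f0 p1 fp s0_gt0 rho1). Qed.
Let s_gt0 i : (0 < s i)%R. Proof. exact: (node_gt0 s0_gt0 rho1). Qed.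
Let yq_le i : (0 <= y i.+1 `^ q - y i `^ q)%R.
Proof. by rewrite subr_ge0; apply: ge0_ler_powR; rewrite ?nnegrE// ltW. Qed.

Let s_le i j : (i <= j)%N -> (s i <= s j)%R.
Proof. by move=> ij; rewrite ler_pM2l// ler_weXn2l// ltW. Qed.

Let step_bound (x : R) : (s 0%N)%:E <= N x -> N x <= (s n)%:E ->
  F x `^ q <= (y 0%N `^ q + \sum_(i < n) (y i.+1 `^ q - y i `^ q) * \1_(U i) x)%:E.
Proof.
have Fy i : N x <= (s i)%:E -> F x `^ q <= (y i `^ q)%:E.
  move=> Ns; rewrite -poweR_EFin; apply: gt0_ler_poweR; first exact: ltW.
  - rewrite in_itv/= leey andbT; apply: integral_ge0 => z _; rewrite lee_fin; exact: f0.
  - by rewrite in_itv/= lee_fin y0 leey.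
  by apply: (integral_le_majorant mf f0 p1 fp s0_gt0 rho1) => //; exact: measurable_itv.
move=> s0N; elim: n => [|k IH] Ns; first by rewrite big_ord0 addr0; exact: Fy.
have [Nk|Nk] := leP (N x) (s k)%:E.
  apply: le_trans (IH Nk) _; rewrite lee_fin big_ord_recr/= lerD2l lerDl.
  by rewrite mulr_ge0 ?yq_le ?indicE ?ler0n.
apply: le_trans (Fy _ Ns) _; rewrite lee_fin.
rewrite (eq_bigr (fun i : 'I_k.+1 => y i.+1 `^ q - y i `^ q)%R); last first.
  move=> i _; rewrite indicE mem_set ?mulr1//=.
  by apply: le_trans (ltW Nk); rewrite lee_fin s_le// -ltnS.
rewrite -(big_mkord xpredT (fun i => y i.+1 `^ q - y i `^ q)%R) telescope_sumr//.
by rewrite addrC subrK.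
Qed.

(** Integration of [step_bound], the measure of each [U i] being controlled by
    [measure_distribution_ge]; [mesh_sum_le] bounds the resulting sum. *)
Lemma window_integral_le :
  \int[mu]_(x in [set x | (s 0%N)%:E <= N x /\ N x <= (s n)%:E]) (F x `^ q) <=
  (b `^ q * (rho `^ q * hardy_k q p `^ q
      * (rho * fine (\int[nu]_x (f x `^ p)%:E)) `^ (q / p)))%:E.
Proof.
set D := [set x | _ /\ _].
have mU i : measurable (U i : set (measurableTypeR R)).
  exact: measurable_up_closed.
have mN : measurable_fun [set: measurableTypeR R] (fun x => N x).
  by apply: nondecreasing_emeasurable; exact: distribution_homo.
have mD : measurable (D : set (measurableTypeR R)).
  rewrite (_ : D = U 0%N `&` [set x | N x <= (s n)%:E]); last by apply/seteqP; split.
  apply: measurableI => //.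
  rewrite (_ : [set x | _] = setT `&` [set x | N x <= (cst (s n)%:E) x]); last by rewrite setTI.
  by apply: emeasurable_fun_le.
(* [h 0] is the initial term and [h i.+1] the [i]-th increment; both [h 0] and [h 1] live on [U 0],
   as [0.-1 = 0]. *)
pose h (i : nat) (x : R) : \bar R :=
  (if i is j.+1 then (y j.+1 `^ q - y j `^ q) else y 0%N `^ q)%:E * (\1_(U i.-1) x)%:E.
have h0 i x : 0 <= h i x by rewrite mule_ge0// lee_fin//; case: i => [|i]; rewrite ?powR_ge0.
have mh i : measurable_fun [set: measurableTypeR R] (h i).
  by apply: measurable_funeM; apply/measurable_EFinP; exact: measurable_indic.
have mF : measurable_fun [set: measurableTypeR R] (fun x => F x `^ q).
  apply: (measurableT_comp (measurable_poweR q)).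
  by apply: nondecreasing_emeasurable; exact: primitive_homo.
have H1 : \int[mu]_(x in D) (F x `^ q) <= \int[mu]_(x in D) \sum_(i < n.+1) h i x.
  apply: ge0_le_integral => //.
  - by move=> x _; exact: poweR_ge0.
  - exact: measurable_funTS.
  - by apply: measurable_funTS; exact: emeasurable_sum.
  move=> x [s0x xsn]; apply: le_trans (step_bound s0x xsn) _.
  rewrite big_ord_recl/= /h/= -EFinM indicE mem_set// mulr1 EFinD leeD2l//.
  by rewrite -sumEFin; apply: lee_sum => i _; rewrite EFinM.
apply: le_trans H1 _.
have H2 : \int[mu]_(x in D) \sum_(i < n.+1) h i x <= \int[mu]_x \sum_(i < n.+1) h i x.
  apply: ge0_subset_integral => //; first exact: emeasurable_sum.
  by move=> x _; exact: sume_ge0.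
apply: le_trans H2 _; rewrite ge0_integral_sum//.
have hE i : \int[mu]_x h i x <=
   ((if i is j.+1 then (y j.+1 `^ q - y j `^ q) else y 0%N `^ q)
     * (b `^ q * s i.-1 `^ (- (q - q / p))))%:E.
  rewrite ge0_integralZl_EFin//.
  - rewrite integral_indic// setIT [leRHS]EFinM; apply: lee_wpmul2l.
      by rewrite lee_fin; case: i => [|i]; rewrite ?powR_ge0.
    exact: measure_distribution_ge.
  - by apply/measurable_EFinP; exact: measurable_indic.
  - by case: i => [|i]; rewrite ?powR_ge0.
apply: (@le_trans _ _ (\sum_(i < n.+1) ((if nat_of_ord i is j.+1
   then (y j.+1 `^ q - y j `^ q) else y 0%N `^ q)
     * (b `^ q * s i.-1 `^ (- (q - q / p))))%:E)).
  by apply: lee_sum => i _; exact: hE.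
rewrite sumEFin lee_fin.
apply: (@le_trans _ _ (b `^ q * (y 0%N `^ q * s 0%N `^ (- (q - q / p))
   + \sum_(i < n) (y i.+1 `^ q - y i `^ q) * s i `^ (- (q - q / p))))%R).
  rewrite big_ord_recl/= mulrDr mulr_sumr mulrCA lerD2l ler_sum// => i _.
  by rewrite mulrCA.
apply: ler_wpM2l; first exact: powR_ge0.
exact: mesh_sum_le.
Qed.

End window.

End hardy_upper.

(** * The upper bound for nonnegative functions on the whole line *)

Section hardy_upper_bound.
Local Open Scope ereal_scope.
Context {R : realType}.
Variables (mu nu : {measure set (measurableTypeR R) -> \bar R}).
Variables (f : measurableTypeR R -> R) (p q b : R).
Hypotheses (mf : measurable_fun setT f) (f0 : forall x, (0 <= f x)%R).
Hypotheses (p1 : (1 < p)%R) (pq : (p <= q)%R) (b0 : (0 <= b)%R).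
Hypothesis muckenhoupt : forall x : R,
  nu `]-oo, x]%classic `^ (conj_exponent p)^-1 * mu `[x, +oo[%classic `^ q^-1 <= b%:E.

Let p0 : (0 < p)%R. Proof. exact: lt_trans p1. Qed.
Let q0 : (0 < q)%R. Proof. exact: lt_le_trans pq. Qed.

Local Notation N x := (nu `]-oo, x]%classic).
Local Notation F x := (\int[nu]_(y in `]-oo, x]) (f y)%:E).

Let mN : measurable_fun [set: measurableTypeR R] (fun x => N x).
Proof. by apply: nondecreasing_emeasurable; exact: distribution_homo. Qed.

Let mF : measurable_fun [set: measurableTypeR R] (fun x => F x `^ q).
Proof.
apply: (measurableT_comp (measurable_poweR q)).
by apply: nondecreasing_emeasurable => x y; exact: primitive_homo.
Qed.

Let F0 x : N x = 0 -> F x `^ q = 0.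
Proof.
move=> Nx; rewrite (@null_set_integral _ _ R nu) ?poweR0r ?gt_eqF//.
by apply/measurable_EFinP; exact: measurable_funTS.
Qed.

Lemma hardy_integral_eq0 : b = 0%R -> \int[mu]_x (F x `^ q) = 0.
Proof.
move=> bE; apply/eqP; rewrite eq_le integral_ge0 ?andbT; last first.
  by move=> x _; exact: poweR_ge0.
rewrite -(integral0 mu [set: measurableTypeR R]).
apply: ae_ge0_le_integral => //.
- by move=> x _; exact: poweR_ge0.
have upN : up_closed [set x | 0 < N x].
  by move=> x y /= Nx xy; apply: lt_le_trans Nx _; exact: distribution_homo.
exists [set x | 0 < N x]; split.
- exact: measurable_up_closed.
- apply/eqP; rewrite eq_le measure_ge0 andbT.
  apply: measure_up_closed_le => // x /= Nx.
  have := muckenhoupt x; rewrite bE.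
  have [->//|m0] := eqVneq (mu `[x, +oo[%classic) 0.
  rewrite leNgt mule_gt0//; first exact: poweR_gt0.
  by rewrite poweR_gt0// lt0e m0 measure_ge0.
- move=> x /= H; rewrite lt0e measure_ge0 andbT; apply/eqP => Nx; apply: H => _.
  by rewrite F0.
Qed.

Hypothesis fp : \int[nu]_x (f x `^ p)%:E < +oo.
Let e := fine (\int[nu]_x (f x `^ p)%:E).

Let e0 : (0 <= e)%R.
Proof. by apply: fine_ge0; apply: integral_ge0 => x _; rewrite lee_fin powR_ge0. Qed.

Let hardy_integral_le_rho (rho : R) : (1 < rho)%R ->
  \int[mu]_x (F x `^ q) <=
  (b `^ q * (rho `^ q * hardy_k q p `^ q * (rho * e) `^ (q / p)))%:E.
Proof.
move=> rho1; have rho0 : (0 < rho)%R by exact: lt_trans rho1.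
pose D n := [set x | (rho ^- n)%:E <= N x /\ N x <= (rho ^+ n)%:E].
have mD n : measurable (D n : set (measurableTypeR R)).
  rewrite (_ : D n = (setT `&` [set x | cst (rho ^- n)%:E x <= N x])
      `&` (setT `&` [set x | N x <= cst (rho ^+ n)%:E x])).
    by apply: measurableI; apply: emeasurable_fun_le.
  by rewrite !setTI; apply/seteqP; split.
have ndD : nondecreasing_seq D.
  move=> n m nm; apply/subsetPset => x [h1 h2]; split.
    apply: le_trans h1; rewrite lee_fin lef_pV2 ?posrE ?exprn_gt0//.
    by rewrite ler_weXn2l// ltW.
  by apply: le_trans h2 _; rewrite lee_fin ler_weXn2l// ltW.
have windowE n : \int[mu]_(x in D n) (F x `^ q) <=
    (b `^ q * (rho `^ q * hardy_k q p `^ q * (rho * e) `^ (q / p)))%:E.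
  have rn0 : (0 < rho ^- n)%R by rewrite invr_gt0 exprn_gt0.
  (* From the first node [rho ^- n], [n + n] steps lead to [rho ^+ n]. *)
  have := window_integral_le mf f0 p1 pq b0 muckenhoupt fp (n + n) rho1 rn0.
  rewrite -/e; congr (_ <= _); congr (integral _ _ _).
  rewrite /node expr0 mulr1 exprD mulrA mulVf ?mul1r//.
  by rewrite gt_eqF// exprn_gt0.
have DE : \bigcup_n D n = [set x | 0 < N x < +oo].
  apply/seteqP; split => x /=.
    move=> [n _ [h1 h2]]; rewrite (lt_le_trans _ h1) ?lte_fin ?invr_gt0 ?exprn_gt0//=.
    by rewrite (le_lt_trans h2) ?ltry.
  move=> /andP[N0 Ny]; have NE : N x = (fine (N x))%:E.
    by rewrite fineK// ge0_fin_numE// ltW.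
  set u := fine _ in NE.
  have u0 : (0 < u)%R by rewrite -lte_fin -NE.
  (* Bernoulli's inequality, [k (rho - 1) <= rho^k]. *)
  have Kbnd (v : R) : exists n, (v <= rho ^+ n)%R.
    exists (Num.bound `|v / (rho - 1)|%R).
    set k := Num.bound _.
    have rho10 : (0 < rho - 1)%R by rewrite subr_gt0.
    have : (v / (rho - 1) <= k%:R)%R.
      by rewrite (le_trans (ler_norm _))// ltW// archi_boundP ?normr_ge0.
    rewrite ler_pdivrMr// => h; apply: (le_trans h).
    elim: k {h} => [|k IH]; first by rewrite mul0r.
    rewrite exprS -natr1.
    have : (1 <= rho ^+ k)%R by rewrite exprn_ege1// ltW.
    by move=> h1; have := ler_wpM2l (ltW rho10) h1; lra.
  have [n1 h1] := Kbnd u; have [n2 h2] := Kbnd (u^-1)%R.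
  exists (maxn n1 n2) => //; rewrite /D/= NE; split; rewrite lee_fin.
    rewrite -[leRHS]invrK lef_pV2 ?posrE ?exprn_gt0 ?invr_gt0//.
    by apply: (le_trans h2); rewrite ler_weXn2l ?leq_maxr// ltW.
  by apply: (le_trans h1); rewrite ler_weXn2l ?leq_maxl// ltW.
have cv := @ge0_nondecreasing_set_cvg_integral _ (measurableTypeR R) R D (fun x => F x `^ q) mu ndD mD
  (fun i => measurable_funTS mF) (fun i x _ => poweR_ge0 _ _).
apply: (@le_trans _ _ (\int[mu]_(x in \bigcup_n D n) (F x `^ q))); last first.
  rewrite -(cvg_lim _ cv)//; apply: lime_le; last exact: nearW.
  by apply/cvg_ex; exists (\int[mu]_(x in \bigcup_n D n) (F x `^ q)).
rewrite [leRHS]integral_mkcond.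
have mU : measurable (\bigcup_n D n : set (measurableTypeR R)) by exact: bigcup_measurable.
apply: ae_ge0_le_integral => //.
- by move=> x _; exact: poweR_ge0.
- by move=> x _; apply: erestrict_ge0 => y _; exact: poweR_ge0.
- by apply/(measurable_restrictT _ _).1 => //; exact: measurable_funTS.
(* Outside all windows either [N x = 0], and then [F x = 0], or [N x = +oo], which happens on a
   [mu]-null set. *)
exists [set x | N x = +oo]; split.
- rewrite (_ : [set x | _] = setT `&` [set x | cst +oo x <= N x]).
    by apply: emeasurable_fun_le.
  by rewrite setTI; apply/seteqP; split => x /=; [move=> ->|rewrite leye_eq => /eqP].
- exact: (measure_distribution_pinfty p1 muckenhoupt).
- move=> x /= H; apply: contrapT => Nx; apply: H => _; rewrite patchE.
  case: ifPn => // xD; rewrite F0 ?poweR_ge0//.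
  apply: contrapT => N0; move: xD; rewrite DE => /negP; apply; apply/mem_set => /=.
  by rewrite lt0e measure_ge0 andbT ltey; apply/andP; split; apply/eqP.
Qed.

Lemma hardy_integral_le :
  \int[mu]_x (F x `^ q) <= ((b * hardy_k q p * e `^ p^-1) `^ q)%:E.
Proof.
set k := hardy_k q p; have k0 := hardy_k_gt0 p1 pq.
have I0 : 0 <= \int[mu]_x (F x `^ q) by apply: integral_ge0 => x _; exact: poweR_ge0.
apply/(lee_mul01Pr _ I0) => t /andP[t0 t1].
pose a := (q + q / p)%R; have a0 : (0 < a)%R by rewrite addr_gt0 ?divr_gt0.
pose rho := (t^-1 `^ a^-1)%R.
have ti1 : (1 < t^-1)%R by rewrite invf_gt1.
have rho1 : (1 < rho)%R.
  have : (1 `^ a^-1 < t^-1 `^ a^-1)%R.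
    by apply: gt0_ltr_powR; rewrite ?nnegrE ?invr_gt0 ?invr_ge0 ?(ltW t0).
  by rewrite powR1.
have rho0 : (0 < rho)%R by exact: lt_trans rho1.
have := hardy_integral_le_rho rho1.
have -> : (b `^ q * (rho `^ q * hardy_k q p `^ q * (rho * e) `^ (q / p)) =
    t^-1 * (b * k * e `^ p^-1) `^ q)%R.
  have -> : t^-1%R = (rho `^ q * rho `^ (q / p))%R.
    rewrite -powRD ?(gt_eqF rho0) ?implybT// -/a /rho -powRrM mulVf ?gt_eqF//.
    by rewrite powRr1// invr_ge0 ltW.
  rewrite !powRM ?mulr_ge0 ?powR_ge0 ?(ltW k0) ?(ltW rho0)// -powRrM [(p^-1 * q)%R]mulrC.
  by rewrite -/k; ring.
rewrite EFinM -lee_pdivrMl ?invr_gt0//.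
by rewrite invrK.
Qed.

End hardy_upper_bound.

(** * Both bounds for an abstract family of inner intervals *)

Section hardy_inequality_bounds.
Local Open Scope ereal_scope.
Context {R : realType}.
Variables (p q : R) (mu nu : {sigma_finite_measure set (measurableTypeR R) -> \bar R}).
Variable I : R -> set R.
Hypotheses (p1 : (1 < p)%R) (pq : (p <= q)%R).
Hypotheses (mI : forall x, measurable (I x : set (measurableTypeR R)))
  (Isub : forall x, I x `<=` `]-oo, x]) (Ihomo : forall x y, (x <= y)%R -> I x `<=` I y).

Let p0 : (0 < p)%R. Proof. exact: lt_trans p1. Qed.
Let q0 : (0 < q)%R. Proof. exact: lt_le_trans pq. Qed.
Let p10 : (0 < p - 1)%R. Proof. by rewrite subr_gt0. Qed.
Let c0 : (0 < conj_exponent p)%R. Proof. exact: divr_gt0. Qed.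
Let q10 : (0 < q^-1)%R. Proof. by rewrite invr_gt0. Qed.

Let measurable_primitive (g : measurableTypeR R -> \bar R) :
  measurable_fun setT g -> (forall x, 0 <= g x) ->
  measurable_fun [set: measurableTypeR R] (fun x => \int[nu]_(y in I x) g y).
Proof.
move=> mg g0; apply: nondecreasing_emeasurable => x y xy.
by apply: ge0_subset_integral => //; [exact: measurable_funTS|exact: Ihomo].
Qed.

(** The primitives of the positive and of the negative part of [f] are both monotone, hence
    measurable. *)
Let measurable_lhs (f : measurableTypeR R -> R) : measurable_fun setT f ->
  measurable_fun [set: measurableTypeR R]
    (fun x => `| \int[nu]_(y in I x) (f y)%:E | `^ q).
Proof.
move=> mf; apply: (measurableT_comp (measurable_poweR q)).
apply: measurableT_comp => //.
under eq_fun do rewrite integralE.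
have mfE : measurable_fun setT (EFin \o f) by exact/measurable_EFinP.
by apply: emeasurable_funB; apply: measurable_primitive;
  do ?[exact: measurable_funepos|exact: measurable_funeneg].
Qed.

Let norm_pow (x : R) : `|x%:E| `^ p = (`|x| `^ p)%:E.
Proof. by []. Qed.

(** Passing to [g], the absolute value of [f], and enlarging [I x] to []-oo, x]] only increase the
    left-hand side. *)
Lemma hardy_inequality_upper (b : R) : (0 <= b)%R ->
  (forall x : R, nu `]-oo, x]%classic `^ (conj_exponent p)^-1
     * mu `[x, +oo[%classic `^ q^-1 <= b%:E) ->
  hardy_inequality I p q mu nu ((hardy_k q p)%:E * b%:E).
Proof.
move=> b0 Hb f mf.
have k0 := hardy_k_gt0 p1 pq.
pose g x := `|f x|%R.
have mg : measurable_fun setT g by exact: measurableT_comp.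
have g0 x : (0 <= g x)%R by exact: normr_ge0.
pose G x := \int[nu]_(y in `]-oo, x]) (g y)%:E.
have mG : measurable_fun [set: measurableTypeR R] (fun x => G x `^ q).
  apply: (measurableT_comp (measurable_poweR q)).
  by apply: nondecreasing_emeasurable => x y; exact: primitive_homo.
have lhs : \int[mu]_x (`| \int[nu]_(y in I x) (f y)%:E | `^ q) <= \int[mu]_x (G x `^ q).
  apply: ge0_le_integral => //.
  - by move=> x _; exact: poweR_ge0.
  - exact: measurable_lhs.
  move=> x _; apply: gt0_ler_poweR; first exact: ltW.
  - by rewrite in_itv/= abse_ge0 leey.
  - by rewrite in_itv/= leey andbT; apply: integral_ge0 => y _; rewrite lee_fin.
  have mfI : measurable_fun (I x : set (measurableTypeR R)) (EFin \o f).
    by apply: measurable_funTS; exact/measurable_EFinP.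
  apply: le_trans (le_abse_integral nu (mI x) mfI) _.
  apply: ge0_subset_integral => //.
    by apply: measurable_funTS; exact/measurable_EFinP.
have E0 : 0 <= \int[nu]_x (g x `^ p)%:E.
  by apply: integral_ge0 => x _; rewrite lee_fin powR_ge0.
have mono (u v : \bar R) : 0 <= u -> u <= v -> u `^ q^-1 <= v `^ q^-1.
  move=> u0 uv; apply: gt0_ler_poweR => //; first exact: ltW.
    by rewrite in_itv/= u0 leey.
  by rewrite in_itv/= (le_trans u0 uv) leey.
have L0 : 0 <= \int[mu]_x (`| \int[nu]_(y in I x) (f y)%:E | `^ q).
  by apply: integral_ge0 => x _; exact: poweR_ge0.
apply: le_trans (mono _ _ L0 lhs) _.
under [X in _ <= _ * X `^ _]eq_integral do rewrite norm_pow.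
(* This case comes first: the right-hand side is then [0] even for an infinite norm of [f], by
   [0 * +oo = 0]. *)
have [bz|bN] := eqVneq b 0%R.
  rewrite (hardy_integral_eq0 mg g0 p1 pq Hb bz) poweR0r ?gt_eqF//.
  by rewrite bz mule0 mul0e.
have bp : (0 < b)%R by rewrite lt_neqAle eq_sym bN.
have [Ey|Ey] := eqVneq (\int[nu]_x (g x `^ p)%:E) +oo.
  rewrite Ey poweRyr ?invr_eq0 ?gt_eqF// gt0_muley ?leey//.
  by rewrite -EFinM lte_fin mulr_gt0.
have Efin : \int[nu]_x (g x `^ p)%:E \is a fin_num by rewrite ge0_fin_numE// ltey.
have fp : \int[nu]_x (g x `^ p)%:E < +oo by rewrite ltey.
have GI0 : 0 <= \int[mu]_x (G x `^ q) by apply: integral_ge0 => x _; exact: poweR_ge0.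
apply: le_trans (mono _ _ GI0 (hardy_integral_le mg g0 p1 pq b0 Hb fp)) _.
rewrite -[in leRHS](fineK Efin) !poweR_EFin -!EFinM lee_fin -powRrM mulfV ?gt_eqF//.
by rewrite powRr1 ?mulr_ge0 ?powR_ge0 ?(ltW k0)// [(b * _)%R]mulrC.
Qed.

Lemma hardy_inequality_lower (A : \bar R) (x : R) : 0 <= A ->
  mu.-negligible [set y | (x <= y)%R /\ nu (`]-oo, x] `\` I y) != 0] ->
  hardy_inequality I p q mu nu A ->
  nu `]-oo, x]%classic `^ (conj_exponent p)^-1 * mu `[x, +oo[%classic `^ q^-1 <= A.
Proof.
move=> A0 negl HA.
set m := mu _ `^ _.
have m0 : 0 <= m by exact: poweR_ge0.
have test (E : set (measurableTypeR R)) : measurable E -> E `<=` `]-oo, x] ->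
    nu E < +oo -> nu E `^ (conj_exponent p)^-1 * m <= A.
  move=> mE Ex Efin; have E0 : 0 <= nu E by exact: measure_ge0.
  have Enum : nu E \is a fin_num by rewrite ge0_fin_numE.
  set a := fine (nu E); have aE : nu E = a%:E by rewrite fineK.
  have a0 : (0 <= a)%R by exact: fine_ge0.
  have [az|aN] := eqVneq a 0%R.
    by rewrite aE az poweR0r ?mul0e// invr_eq0 gt_eqF.
  have ap : (0 < a)%R by rewrite lt_neqAle eq_sym aN.
  have mE1 : measurable_fun setT (\1_E : measurableTypeR R -> R) by exact: measurable_indic.
  have := HA _ mE1.
  have -> : \int[nu]_y (`| (\1_E y)%:E | `^ p) = a%:E.
    rewrite -aE -[E in RHS]setIT -integral_indic//.
    apply: eq_integral => y _; rewrite poweR_EFin indicE; case: (y \in E) => /=.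
      by rewrite normr1 powR1.
    by rewrite normr0 powR0// gt_eqF.
  have low : (a `^ q)%:E * mu `[x, +oo[%classic <=
     \int[mu]_z (`| \int[nu]_(y in I z) (\1_E y)%:E | `^ q).
    have -> : (a `^ q)%:E * mu `[x, +oo[%classic =
        \int[mu]_z ((a `^ q)%:E * (\1_(`[x, +oo[%classic) z)%:E).
      rewrite ge0_integralZl_EFin ?powR_ge0 ?integral_indic ?setIT//.
      by apply/measurable_EFinP; exact: measurable_indic.
    apply: ae_ge0_le_integral => //.
    - by move=> z _; rewrite mule_ge0 ?lee_fin ?powR_ge0.
    - by apply: measurable_funeM; apply/measurable_EFinP; exact: measurable_indic.
    - by move=> z _; exact: poweR_ge0.
    - exact: measurable_lhs.
    (* A point [z] where the bound fails satisfies [x <= z], and [I z] misses a non-null part of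
       []-oo, x]]; otherwise the inner integral is [nu E]. *)
    apply: negligibleS negl => z /= H; split.
      rewrite leNgt; apply/negP => zx; apply: H => _.
      rewrite indicE memNset ?mule0 ?poweR_ge0//=.
      by rewrite in_itv/= andbT; apply/negP; rewrite -ltNge.
    apply/eqP => nz; apply: H => _.
    have -> : \int[nu]_(y in I z) (\1_E y)%:E = a%:E.
      rewrite integral_indic// -aE; apply/eqP; rewrite eq_le; apply/andP; split.
        by apply: le_measure; rewrite ?inE//; exact: measurableI.
      rewrite (measureDI nu mE (mI z)) -[leRHS]add0e leeD2r//.
      have mD : measurable (`]-oo, x]%classic `\` I z : set (measurableTypeR R)).
        by apply: measurableD => //; exact: measurable_itv.
      rewrite -nz; apply: le_measure; rewrite ?inE//; first exact: measurableD.
      exact: setSD.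
    have aE0 : 0 <= a%:E by rewrite lee_fin.
    rewrite (gee0_abs aE0) poweR_EFin -EFinM lee_fin indicE.
    by case: (_ \in _); rewrite ?mulr1 ?mulr0 ?powR_ge0.
  move=> H.
  have {}H : (a `^ q)%:E `^ q^-1 * m <= A * a%:E `^ p^-1.
    apply: le_trans H; rewrite /m -poweRM ?lee_fin ?powR_ge0//.
    apply: gt0_ler_poweR => //; first exact: ltW.
    - by rewrite in_itv/= leey andbT mule_ge0// lee_fin powR_ge0.
    - rewrite in_itv/= leey andbT; apply: integral_ge0 => z _; exact: poweR_ge0.
  have ar0 : (0 < a `^ p^-1)%R by exact: powR_gt0.
  (* Both sides are compared after multiplication by [a^(1/p)]; the exponents [1/p] and that of the
     conjugate add up to [1]. *)
  rewrite aE -(@lee_pmul2r _ (a `^ p^-1)%:E)//.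
  apply: le_trans H; rewrite !poweR_EFin muleAC -EFinM -powRrM mulfV ?gt_eqF//.
  rewrite -powRD ?(gt_eqF ap) ?implybT//.
  by have -> : ((conj_exponent p)^-1 + p^-1 = 1)%R
    by rewrite /conj_exponent; field; rewrite !gt_eqF.
have [->|mN] := eqVneq m 0; first by rewrite mule0.
have mp : 0 < m by rewrite lt0e mN.
have [->|Ay] := eqVneq A +oo; first by rewrite leey.
have Afin : A \is a fin_num by rewrite ge0_fin_numE// ltey.
(* The half-line may have infinite [nu]-measure, so it is exhausted by sets of finite measure. *)
have /sigma_finiteP[S [ST Snd Soo]] := sigma_finiteT nu.
have mx : measurable (`]-oo, x]%classic : set (measurableTypeR R)) by exact: measurable_itv.
have nuE c : (forall n, nu (S n `&` `]-oo, x]%classic) <= c) -> nu `]-oo, x]%classic <= c.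
  move=> Sc; have -> : `]-oo, x]%classic = \bigcup_n (S n `&` `]-oo, x]%classic).
    by rewrite -setI_bigcupl -ST setTI.
  apply: measure_bigcup_le => //.
  - by move=> n; apply: measurableI => //; exact: (Soo n).1.
  - move=> n k nk; apply/subsetPset; apply: setSI; exact/subsetPset/Snd.
have Stest n : nu (S n `&` `]-oo, x]%classic) `^ (conj_exponent p)^-1 * m <= A.
  have [mS Sfin] := Soo n.
  apply: test; first exact: measurableI.
    exact: subIsetr.
  apply: le_lt_trans Sfin; apply: le_measure; rewrite ?inE//; first exact: measurableI.
have [my|my] := eqVneq m +oo.
  have n0 n : nu (S n `&` `]-oo, x]%classic) <= 0.
    rewrite leNgt; apply/negP => np; have := Stest n.
    rewrite my gt0_muley ?poweR_gt0//.
    by rewrite leye_eq (negbTE Ay).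
  have -> : nu `]-oo, x]%classic = 0 by apply/eqP; rewrite eq_le measure_ge0 (nuE _ n0).
  by rewrite poweR0r ?mul0e// invr_eq0 gt_eqF.
have mfin : m \is a fin_num by rewrite ge0_fin_numE// ltey.
move: (Stest) (m0) (mp); rewrite -(fineK mfin) -(fineK Afin).
set mr := fine m; set Ar := fine A => {}Stest mr0 mrp.
rewrite lte_fin in mrp.
have Ar0 : (0 <= Ar / mr)%R by rewrite divr_ge0 ?fine_ge0// ltW.
(* The inequality is solved for the measure, so that the limit concerns [nu] itself and not its
   power. *)
have Sc n : nu (S n `&` `]-oo, x]%classic) <= ((Ar / mr) `^ conj_exponent p)%:E.
  have := Stest n; rewrite -lee_pdivlMr// -EFinM => H.
  have := @gt0_ler_poweR R _ (ltW c0) _ _ _ _ H.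
  rewrite -poweRrM mulVf ?gt_eqF// poweRe1//; apply.
    by rewrite in_itv/= poweR_ge0 leey.
  by rewrite in_itv/= lee_fin Ar0 leey.
rewrite -lee_pdivlMr// -EFinM.
have := @gt0_ler_poweR R (conj_exponent p)^-1 _ _ _ _ _ (nuE _ Sc).
rewrite poweR_EFin -powRrM mulfV ?gt_eqF// powRr1//; apply.
- by rewrite invr_ge0 ltW.
- by rewrite in_itv/= measure_ge0 leey.
- by rewrite in_itv/= lee_fin powR_ge0 leey.
Qed.

Lemma hardy_B_ge0 : 0 <= hardy_B p q mu nu.
Proof.
apply: (@le_trans _ _ (nu `]-oo, 0%R]%classic `^ (conj_exponent p)^-1
    * mu `[0%R, +oo[%classic `^ q^-1)); first by rewrite mule_ge0 ?poweR_ge0.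
by apply: ereal_sup_ubound; exists 0%R.
Qed.

Lemma hardy_optimal_le :
  hardy_optimal I p q mu nu <= (hardy_k q p)%:E * hardy_B p q mu nu.
Proof.
have k0 := hardy_k_gt0 p1 pq.
have B0 := hardy_B_ge0.
have [->|By] := eqVneq (hardy_B p q mu nu) +oo.
  by rewrite gt0_muley ?leey// lte_fin.
have Bfin : hardy_B p q mu nu \is a fin_num by rewrite ge0_fin_numE// ltey.
apply: ereal_inf_lbound; split; first by rewrite mule_ge0// lee_fin ltW.
rewrite -(fineK Bfin); apply: hardy_inequality_upper; first exact: fine_ge0.
by move=> x; rewrite fineK//; apply: ereal_sup_ubound; exists x.
Qed.

Lemma hardy_optimal_ge :
  (forall x, mu.-negligible [set y | (x <= y)%R /\ nu (`]-oo, x] `\` I y) != 0]) ->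
  hardy_B p q mu nu <= hardy_optimal I p q mu nu.
Proof.
move=> negl; apply: ge_ereal_sup => _ [x _ <-]; apply: le_ereal_inf_tmp => A [A0 HA].
exact: hardy_inequality_lower.
Qed.

End hardy_inequality_bounds.

(** * The estimate for closed and for open inner intervals *)

Local Open Scope ereal_scope.

(* With ]-oo, x[ and a common atom, B <= A fails: for mu = nu = \d_0 and that
   interval, A = 0 while B = 1.  The two-sided bound therefore holds for ]-oo, x]
   in general, and for ]-oo, x[ when mu and nu have no common atom; the upper
   bound holds for ]-oo, x[ in general. *)
Theorem theorem1p1 (R : realType) (p q : R) (hp : (1 < p)%R) (hpq : (p <= q)%R)
    (mu nu : {sigma_finite_measure set (measurableTypeR R) -> \bar R}) :
  let B := hardy_B p q mu nu in
  let k := (hardy_k q p)%:E in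
  (let A := hardy_optimal (fun x => `]-oo, x]%classic) p q mu nu in
   B <= A /\ A <= k * B) /\
  (let A := hardy_optimal (fun x => `]-oo, x[%classic) p q mu nu in
   (no_common_atom mu nu -> B <= A) /\ A <= k * B).
Proof.
have cc x y : (x <= y)%R -> `]-oo, x] `<=` (`]-oo, y] : set R).
  by move=> xy; apply: subset_itvl; rewrite bnd_simp.
have oc (x : R) : `]-oo, x[ `<=` (`]-oo, x] : set R).
  by apply: subset_itvl; rewrite bnd_simp.
have oo x y : (x <= y)%R -> `]-oo, x[ `<=` (`]-oo, y[ : set R).
  by move=> xy; apply: subset_itvl; rewrite bnd_simp.
split; split.
- apply: hardy_optimal_ge => // x.
  rewrite (_ : [set y | _] = set0); first exact: negligible_set0.
  apply/seteqP; split => // y [xy].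
  have -> : `]-oo, x]%classic `\` `]-oo, y]%classic = set0 by rewrite setD_eq0; exact: cc.
  by rewrite measure0 eqxx.
- by apply: hardy_optimal_le => // x; exact: subset_refl.
- move=> atoms; apply: hardy_optimal_ge => // x.
  (* For [y > x] the difference of the half-lines is empty, and for [y = x] it is the point [x].
     Hence the exceptional set lies in the singleton of [x], and it is empty if that singleton is
     [nu]-null. *)
  have [mux|nux] := atoms x.
    exists [set x]; split => // y [xy] /eqP nz; apply/eqP; apply: contrapT => yx; apply: nz.
    suff -> : `]-oo, x]%classic `\` `]-oo, y[%classic = set0 by rewrite measure0.
    rewrite setD_eq0 => z /=; rewrite !in_itv/= => zx.
    by apply: (le_lt_trans zx); rewrite lt_neqAle xy andbT eq_sym; apply/negP.
  rewrite (_ : [set y | _] = set0); first exact: negligible_set0.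
  apply/seteqP; split => // y [xy] /eqP; apply.
  apply/eqP; rewrite eq_le measure_ge0 andbT -nux; apply: le_measure; rewrite ?inE//.
    by apply: measurableD; exact: measurable_itv.
  move=> z []; rewrite /= !in_itv/= => zx /negP; rewrite -leNgt => yz.
  by apply/eqP; rewrite eq_le zx (le_trans xy).
- by apply: hardy_optimal_le.
Qed.
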